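(* Let $k$ be a positive integer and let $D$ be a digraph of order $n$, where $n \ge 12k+3$. If $d_{D}^{+}(u) + d_{D}^{-}(v) \ge n$ for every two distinct vertices $u$ and $v$ of $D$ with $(u,v) \notin A(D)$, then $D$ has a directed $2$-factor consisting of exactly $k$ directed cycles, each of length at least $3$.
   Context: A digraph is finite, without loops or multiple arcs (a pair of opposite arcs $(u,v),(v,u)$ is allowed). $A(D)$ is the arc set, $d_D^+(v)$ and $d_D^-(v)$ are the out-degree and in-degree of $v$. A directed $2$-factor of $D$ is a spanning subdigraph in which every component is a directed cycle. *)

(* Defs.v *)
From mathcomp Require Import all_boot.
Set Implicit Arguments. Unset Strict Implicit. Unset Printing Implicit Defensive.

(* A digraph on a finite vertex type V is an arc relation a : rel V;
   (u,v) is an arc iff a u v.  "No loops" is the hypothesis irreflexive a.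
   Opposite arcs are allowed; multiple arcs cannot occur in a relation. *)

Definition outdeg (V : finType) (a : rel V) (u : V) : nat := #|[set v | a u v]|.
Definition indeg  (V : finType) (a : rel V) (v : V) : nat := #|[set u | a u v]|.

Definition dicycle (V : finType) (a : rel V) (c : seq V) : bool :=
  [&& 2 <= size c, uniq c & cycle a c].

Definition di2factor (V : finType) (a : rel V) (cs : seq (seq V)) : Prop :=
  [/\ all (dicycle a) cs, uniq (flatten cs) & forall v : V, v \in flatten cs].

(* Main.v *)
Require Import Defs.
From mathcomp Require Import all_boot zify.
From Stdlib Require Import Classical.
Set Implicit Arguments. Unset Strict Implicit. Unset Printing Implicit Defensive.

(** Write a packing for a family of disjoint cycles of length at least 3.  A path fits into a
    cycle at an arc (p, succ p) when p dominates its head and its last vertex dominates succ p;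
    a packing is stuck when no path of uncovered vertices fits anywhere.  The degree condition
    makes the uncovered part of a stuck packing strong and again of Woodall type, which gives
    Woodall's theorem (k = 1) and Hamiltonian paths with a prescribed end in the uncovered part.

    For k >= 2 one finds k + 1 disjoint cycles of length 3 or 4 and then loses one cycle while
    covering everything.  The short cycles are found greedily: if the uncovered part
    has no cycle of length 3 or 4, two disjoint short paths through vertices of large degree can
    both be closed through one cycle of the packing, which is thereby replaced by two.  A
    packing of maximal cover is then taken.  If it is not spanning, a Hamiltonian path of the
    uncovered part followed by one opened cycle fits into another cycle, leaving a k-factor.
    If it is spanning, its smallest cycle is dissolved: as many of its vertices as possible are
    moved into the other cycles.  If at least 3 remain they form a smaller cycle (induction); if
    1 or 2 remain, counting degrees lets them be inserted as well. *)

(** The number of cycles is prescribed, so cycles cannot be merged at will, and each must keep three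
    vertices. The degree condition mostly acts as follows: if [(y, x)] is a nonarc and a path from
    [x] to [y] fits nowhere, the arcs from the cycles to [x] and from [y] to the cycles number at
    most the covered vertices. The rest of the degree sum has to be found inside the uncovered part,
    where there is no room for it. A fitting path may also replace a longer segment of a cycle. The
    vertices of that segment go back in one at a time: if the segment is chosen as short as possible
    they are nonadjacent to what replaced them, so their degrees are large. The spare cycle supplies
    a nonarc. If [v] receives an arc from the uncovered part, its predecessor sends none there; so
    the path that ends with the cycle opened just before [v] has no arc from its end to its head.
    For [k >= 2] the bound on [n] enters twice: in the greedy step, where two uncovered vertices
    share at most 12 arcs with a short cycle, and through [n > 4(k+1)], which yields a cycle of at
    least five vertices besides a smallest one. *)

(* lia compares atoms up to conversion, which diverges on cardinals: hide them first. *)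
Ltac hide_nat :=
  repeat match goal with
  | |- context [outdeg ?b ?x] => generalize (outdeg b x)
  | |- context [indeg ?b ?x] => generalize (indeg b x)
  | |- context [@card ?T ?x] => generalize (@card T x)
  | |- context [@size ?T ?x] => generalize (@size T x)
  end; clear.
Ltac card_lia := rewrite /=; hide_nat; intros; lia.

Section SeqLemmas.
Variable T : eqType.
Implicit Types (x y : T) (c s : seq T).

Lemma next_cat_cons (A B : seq T) x y :
  uniq (A ++ x :: y :: B) -> next (A ++ x :: y :: B) x = y.
Proof.
move=> U.
have E : rot (size A) (A ++ x :: y :: B) = x :: y :: B ++ A by rewrite rot_size_cat.
by rewrite -(next_rot (size A) U) E /= eqxx.
Qed.

Lemma next_cat_last (A : seq T) x : uniq (rcons A x) -> next (rcons A x) x = head x A.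
Proof.
move=> U; rewrite -(next_rot (size A) U) -cats1 rot_size_cat /=.
by case: A {U} => [|y A] /=; rewrite eqxx.
Qed.

Lemma next_head x s : uniq (x :: s) -> next (x :: s) x = head x s.
Proof. by case: s => [|y s] _ /=; rewrite eqxx. Qed.

Lemma rot_to_head c x : uniq c -> x \in c ->
  exists2 s, rot (index x c) c = x :: s & next c x = head x s.
Proof.
move=> U xc; exists (behead (rot (index x c) c)); first by rewrite rot_index.
rewrite -(next_rot (index x c) U) rot_index // next_head //.
by rewrite -rot_index // rot_uniq.
Qed.

Lemma cycle_insert (e : rel T) x s P : path e x (rcons P (head x s)) ->
  cycle e (x :: s) -> cycle e (x :: P ++ s).
Proof.
case: s => [|y s] /=; first by rewrite cats0.
by rewrite rcons_cat cat_path !rcons_path /= => /andP[-> ->] /andP[_ ->].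
Qed.

(** Scan from [u], remembering the latest [O]-vertex [w] and the run [G] of neutral vertices since.
    An [I]-vertex ends the scan, another [O]-vertex restarts it with an empty run. [I] is tested
    first, so a vertex in both sets ends the scan. *)
Lemma tight_pair (O I : pred T) u v (X : seq T) : O u -> I v ->
  exists A o G i B, [/\ u :: rcons X v = A ++ o :: G ++ i :: B, O o, I i &
     all (fun w => ~~ O w && ~~ I w) G].
Proof.
move=> Ou Iv.
suff gen : forall (Y G : seq T) w, O w -> all (fun w => ~~ O w && ~~ I w) G ->
  exists A o G' i B, [/\ w :: G ++ rcons Y v = A ++ o :: G' ++ i :: B, O o, I i &
     all (fun w => ~~ O w && ~~ I w) G'] by apply: (gen X [::]).
elim=> [|y Y IH] G w Ow aG.
  by exists [::], w, G, v, [::]; split=> //; rewrite cats1.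
case Iy: (I y).
  by exists [::], w, G, y, (rcons Y v).
case Oy: (O y).
  have [A [o [G' [i [B [E Oo Ii aG']]]]]] := IH [::] y Oy isT.
  exists (w :: G ++ A), o, G', i, B; split=> //=.
  by rewrite /= in E; rewrite E catA.
have aG2 : all (fun w => ~~ O w && ~~ I w) (rcons G y) by rewrite all_rcons Oy Iy.
by have := IH _ w Ow aG2; rewrite cat_rcons.
Qed.

End SeqLemmas.

Section Digraph.
Variables (V : finType) (a : rel V).
Implicit Types (x y u v w p : V) (c s P G : seq V) (A B S : {set V}).

Definition outin v A := #|[set u in A | a v u]|.
Definition inin v A := #|[set u in A | a u v]|.

Lemma outinT v : outdeg a v = outin v setT.
Proof. by apply: eq_card => x; rewrite !inE. Qed.
Lemma ininT v : indeg a v = inin v setT.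
Proof. by apply: eq_card => x; rewrite !inE. Qed.

Lemma outinU v A B : [disjoint A & B] -> outin v (A :|: B) = outin v A + outin v B.
Proof.
move=> dAB; rewrite /outin -[RHS]cardsUI.
have -> : [set u in A | a v u] :&: [set u in B | a v u] = set0.
  apply/setP=> x; rewrite !inE; case: (boolP (x \in A)) => //= xA.
  by rewrite (disjointFr dAB xA) andbF.
by rewrite cards0 addn0; apply: eq_card => x; rewrite !inE andb_orl.
Qed.
Lemma ininU v A B : [disjoint A & B] -> inin v (A :|: B) = inin v A + inin v B.
Proof.
move=> dAB; rewrite /inin -[RHS]cardsUI.
have -> : [set u in A | a u v] :&: [set u in B | a u v] = set0.
  apply/setP=> x; rewrite !inE; case: (boolP (x \in A)) => //= xA.
  by rewrite (disjointFr dAB xA) andbF.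
by rewrite cards0 addn0; apply: eq_card => x; rewrite !inE andb_orl.
Qed.

Lemma disjC A : [disjoint A & ~: A].
Proof. by rewrite -setI_eq0 setICr. Qed.

Lemma outdegC v A : outdeg a v = outin v A + outin v (~: A).
Proof. by rewrite outinT -outinU ?disjC // setUCr. Qed.
Lemma indegC v A : indeg a v = inin v A + inin v (~: A).
Proof. by rewrite ininT -ininU ?disjC // setUCr. Qed.

Lemma outinD v A B : B \subset A -> outin v A = outin v (A :\: B) + outin v B.
Proof.
move=> sBA; rewrite -outinU; last by rewrite disjoints_subset setDE subsetIr.
by rewrite setUC -{1}(setIidPr sBA) setID.
Qed.
Lemma ininD v A B : B \subset A -> inin v A = inin v (A :\: B) + inin v B.
Proof.
move=> sBA; rewrite -ininU; last by rewrite disjoints_subset setDE subsetIr.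
by rewrite setUC -{1}(setIidPr sBA) setID.
Qed.

Lemma outin_le v A : outin v A <= #|A|.
Proof. by apply/subset_leq_card/subsetP=> x; rewrite inE => /andP[]. Qed.
Lemma inin_le v A : inin v A <= #|A|.
Proof. by apply/subset_leq_card/subsetP=> x; rewrite inE => /andP[]. Qed.

Lemma outin_avoid v A B : B \subset A -> (forall x, x \in B -> ~~ a v x) ->
  outin v A + #|B| <= #|A|.
Proof.
move=> sBA nB; rewrite -[leqRHS](cardsID B) addnC (setIidPr sBA) leq_add2l.
apply/subset_leq_card/subsetP=> x; rewrite !inE => /andP[-> vx]; rewrite andbT.
by apply: contraL vx; apply: nB.
Qed.
Lemma inin_avoid v A B : B \subset A -> (forall x, x \in B -> ~~ a x v) ->
  inin v A + #|B| <= #|A|.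
Proof.
move=> sBA nB; rewrite -[leqRHS](cardsID B) addnC (setIidPr sBA) leq_add2l.
apply/subset_leq_card/subsetP=> x; rewrite !inE => /andP[-> vx]; rewrite andbT.
by apply: contraL vx; apply: nB.
Qed.

Lemma outin0 v A : (forall x, x \in A -> ~~ a v x) -> outin v A = 0.
Proof. by move=> nA; have := outin_avoid (subxx A) nA; lia. Qed.
Lemma inin0 v A : (forall x, x \in A -> ~~ a x v) -> inin v A = 0.
Proof. by move=> nA; have := inin_avoid (subxx A) nA; lia. Qed.

Hypothesis airr : irreflexive a.

Lemma outin_self v A : v \in A -> outin v A < #|A|.
Proof.
move=> vA; have := @outin_avoid v A [set v]; rewrite sub1set vA cards1 addn1; apply=> //.
by move=> x /set1P->; rewrite airr.
Qed.
Lemma inin_self v A : v \in A -> inin v A < #|A|.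
Proof.
move=> vA; have := @inin_avoid v A [set v]; rewrite sub1set vA cards1 addn1; apply=> //.
by move=> x /set1P->; rewrite airr.
Qed.

Lemma outin_self2 v w A : v \in A -> w \in A -> v != w -> ~~ a v w -> (outin v A).+1 < #|A|.
Proof.
move=> vA wA vw nvw; have := @outin_avoid v A [set v; w]; rewrite cards2 vw /= addn2; apply.
  by apply/subsetP=> x /set2P[]->.
by move=> x /set2P[]->; rewrite ?airr.
Qed.
Lemma inin_self2 v w A : v \in A -> w \in A -> v != w -> ~~ a w v -> (inin v A).+1 < #|A|.
Proof.
move=> vA wA vw nvw; have := @inin_avoid v A [set v; w]; rewrite cards2 vw /= addn2; apply.
  by apply/subsetP=> x /set2P[]->.
by move=> x /set2P[]->; rewrite ?airr.
Qed.

End Digraph.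

Ltac degree_lia := rewrite /=;
  repeat match goal with
  | |- context [outin ?b ?x ?A] => generalize (outin b x A)
  | |- context [inin ?b ?x ?A] => generalize (inin b x A)
  end; card_lia.

(** * Packings and insertion *)

Section Packing.
Variables (V : finType) (a : rel V).
Implicit Types (x y u v w p : V) (c s P G : seq V) (A B S : {set V}).

Definition long_cycle c := [&& 3 <= size c, uniq c & cycle a c].

(** The cycles are indexed by a finite type so that their number is fixed by the type and a cycle
    keeps its index when it is enlarged; losing a cycle is the passage from ['I_k.+1] to ['I_k]. *)
Definition packing (I : finType) (C : I -> seq V) : Prop :=
  (forall i, long_cycle (C i)) /\ (forall i j x, x \in C i -> x \in C j -> i = j).

Definition covered (I : finType) (C : I -> seq V) : {set V} := [set x | [exists i, x \in C i]].

Definition upd (I : finType) (C : I -> seq V) j c : I -> seq V :=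
  fun i => if i == j then c else C i.

(* The identity off the cycles. *)
Definition succ (I : finType) (C : I -> seq V) p : V :=
  if [pick i | p \in C i] is Some i then next (C i) p else p.

Definition ins (I : finType) (C : I -> seq V) j p P : I -> seq V :=
  upd C j (p :: P ++ behead (rot (index p (C j)) (C j))).

Section Index.
Variable I : finType.
Implicit Types (C : I -> seq V) (i j : I).

Lemma coveredP C x : reflect (exists i, x \in C i) (x \in covered C).
Proof. by rewrite inE; apply: existsP. Qed.

Lemma mem_covered C i x : x \in C i -> x \in covered C.
Proof. by move=> xi; apply/coveredP; exists i. Qed.

Lemma packing_uniq C i : packing C -> uniq (C i).
Proof. by case=> /(_ i)/and3P[]. Qed.
Lemma packing_cycle C i : packing C -> cycle a (C i).
Proof. by case=> /(_ i)/and3P[]. Qed.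
Lemma packing_size C i : packing C -> 3 <= size (C i).
Proof. by case=> /(_ i)/and3P[]. Qed.

Lemma succE C i p : packing C -> p \in C i -> succ C p = next (C i) p.
Proof.
move=> [_ dC] pi; rewrite /succ; case: pickP => [j pj|/(_ i)]; last by rewrite pi.
by rewrite (dC _ _ _ pj pi).
Qed.

Lemma succ_rot C i n c p : packing C -> p \in C i -> rot n (C i) = c -> succ C p = next c p.
Proof. by move=> pC pi <-; rewrite (succE pC pi) next_rot ?packing_uniq. Qed.

Lemma succ_off C p : p \notin covered C -> succ C p = p.
Proof.
move=> np; rewrite /succ; case: pickP => // i pi.
by rewrite (mem_covered pi) in np.
Qed.

Lemma succ_mem C i p : packing C -> (succ C p \in C i) = (p \in C i).
Proof.
move=> pC; case: (boolP (p \in covered C)) => [/coveredP[j pj]|np]; last by rewrite succ_off.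
rewrite (succE pC pj); have nj : next (C j) p \in C j by rewrite mem_next.
by apply/idP/idP => h; case: pC => _ dC; [rewrite (dC _ _ _ h nj)|rewrite (dC _ _ _ h pj)].
Qed.

Lemma succ_covered C p : packing C -> (succ C p \in covered C) = (p \in covered C).
Proof.
move=> pC; apply/coveredP/coveredP=> -[i]; first by rewrite succ_mem //; exists i.
by exists i; rewrite succ_mem.
Qed.

Lemma succ_inj C : packing C -> injective (succ C).
Proof.
move=> pC p q E.
case: (boolP (p \in covered C)) => [/coveredP[i pi]|np].
  have qi : q \in C i by rewrite -(succ_mem _ _ pC) -E succ_mem.
  rewrite (succE pC pi) (succE pC qi) in E.
  by rewrite -(prev_next (packing_uniq i pC) p) E prev_next ?packing_uniq.
case: (boolP (q \in covered C)) => [|nq]; last by rewrite -(succ_off np) E succ_off.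
by rewrite -(succ_covered q pC) -E succ_covered // (negbTE np).
Qed.

Lemma succ_arc C p : packing C -> p \in covered C -> a p (succ C p).
Proof.
move=> pC /coveredP[i pi]; rewrite (succE pC pi).
exact: next_cycle (packing_cycle i pC) pi.
Qed.

Lemma succ_surj C i q : packing C -> q \in C i -> exists2 p, p \in C i & succ C p = q.
Proof.
move=> pC qi; exists (prev (C i) q); first by rewrite mem_prev.
by rewrite (succE pC (i := i)) ?mem_prev // next_prev // packing_uniq.
Qed.

Lemma upd_packing C j c : packing C -> long_cycle c ->
  (forall i x, i != j -> x \in c -> x \notin C i) -> packing (upd C j c).
Proof.
move=> [gC dC] gc hc; split=> [i|i i' x]; rewrite /upd; first by case: ifP.
case: (eqVneq i j) => [->|ij]; case: (eqVneq i' j) => [->|ij'] //; last exact: dC.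
  by move=> xc xi; have := hc _ _ ij' xc; rewrite xi.
by move=> xi xc; have := hc _ _ ij xc; rewrite xi.
Qed.

Lemma upd_eq C j c : upd C j c j = c.
Proof. by rewrite /upd eqxx. Qed.
Lemma upd_neq C j c i : i != j -> upd C j c i = C i.
Proof. by rewrite /upd => /negbTE->. Qed.

Lemma covered_upd C j c : packing C ->
  covered (upd C j c) = (covered C :\: [set x in C j]) :|: [set x in c].
Proof.
move=> [_ dC]; apply/setP=> x; rewrite !inE; apply/existsP/orP => [[i]|].
  rewrite /upd; case: eqP => [_|/eqP ij] xi; first by right.
  left; apply/andP; split; last by apply/existsP; exists i.
  by apply: contraNN ij => /(dC _ _ _ xi)->.
case=> [/andP[xj /existsP[i xi]]|xc]; last by exists j; rewrite upd_eq.
exists i; rewrite upd_neq //; apply: contraNneq xj => <-; exact: xi.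
Qed.

Lemma ins_spec C j p x s : packing C -> p \in C j -> uniq (x :: s) -> path a x s ->
  (forall z, z \in x :: s -> z \notin covered C) -> a p x -> a (last x s) (succ C p) ->
  [/\ packing (ins C j p (x :: s)),
      (forall i z, (z \in ins C j p (x :: s) i) = (z \in C i) || (i == j) && (z \in x :: s)) &
      covered (ins C j p (x :: s)) = covered C :|: [set z in x :: s]].
Proof.
move=> pC pj uP pP dP apx aly; set P := x :: s in uP dP *.
have [r Er nr] := rot_to_head (packing_uniq j pC) pj.
have Ej z : z \in C j = (z \in p :: r) by rewrite -(mem_rot (index p (C j))) Er.
have U : uniq (p :: r) by rewrite -Er rot_uniq packing_uniq.
have S : 3 <= size (p :: r) by rewrite -Er size_rot packing_size.
have Cy : cycle a (p :: r) by rewrite -Er rot_cycle packing_cycle.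
have mE i z : (z \in ins C j p P i) = (z \in C i) || (i == j) && (z \in P).
  rewrite /ins; case: (eqVneq i j) => [->|ij]; last by rewrite upd_neq //= orbF.
  by rewrite upd_eq Ej Er [LHS]inE mem_cat [z \in p :: r]inE -orbA; congr orb; rewrite orbC.
have pk : packing (ins C j p P).
  rewrite /ins Er; apply: upd_packing => //.
    apply/and3P; split; first by rewrite /= size_cat; move: S => /=; lia.
      have /andP[pr Ur] : (p \notin r) && uniq r := U.
      have pnP : p \notin P by apply/negP=> /dP; rewrite (mem_covered pj).
      rewrite cons_uniq mem_cat (negbTE pnP) (negbTE pr) cat_uniq uP Ur andbT andTb.
      apply/hasPn=> z zr; apply/negP=> /dP; rewrite (mem_covered (i := j)) // Ej inE zr orbT //.
    apply: cycle_insert => //=; rewrite apx rcons_path pP /=.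
    by rewrite -nr -(succE pC pj).
  move=> i z ij; rewrite inE mem_cat => zP; apply/negP=> zi.
  have /orP[zc|zP'] : (z \in p :: r) || (z \in P).
    by rewrite inE; case/or3P: zP => ->; rewrite ?orbT.
    rewrite -Ej in zc; case: pC => _ dC; move/eqP: ij; apply; exact: dC zi zc.
  by have := dP _ zP'; rewrite (mem_covered zi).
split=> //; apply/setP=> z; apply/coveredP/setUP => [[i]|[/coveredP[i zi]|]].
- by rewrite mE => /orP[/mem_covered|/andP[_]]; [left|right; rewrite inE].
- by exists i; rewrite mE zi.
- by rewrite inE => zP; exists j; rewrite mE eqxx zP orbT.
Qed.

(* A slot is a pair (p, succ p) between which a path from x to y fits. *)
Lemma slot_count C B x y : packing C -> (forall p, p \in B -> succ C p \in B) ->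
  (forall p, p \in B -> a p x -> ~~ a y (succ C p)) -> inin a x B + outin a y B <= #|B|.
Proof.
(* [succ C] maps the in-neighbours of [x] in [B] injectively into [B], and the image misses the
   out-neighbours of [y]. *)
move=> pC iB nB; rewrite /inin -(card_imset _ (succ_inj pC)) /outin -cardsUI.
have -> : [set succ C q | q in [set u in B | a u x]] :&: [set u in B | a y u] = set0.
  apply/setP=> z; rewrite !inE; apply/negP=> /and3P[/imsetP[q]].
  by rewrite inE => /andP[qB qx] -> _; rewrite (negbTE (nB _ qB qx)).
rewrite cards0 addn0; apply/subset_leq_card/subsetP=> z /setUP[/imsetP[q]|].
  by rewrite inE => /andP[qB _] ->; apply: iB.
by rewrite inE => /andP[].
Qed.

Lemma slot_count_covered C x y : packing C ->
  (forall p, p \in covered C -> a p x -> ~~ a y (succ C p)) ->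
  inin a x (covered C) + outin a y (covered C) <= #|covered C|.
Proof. by move=> pC; apply: slot_count => // p; rewrite succ_covered. Qed.

Hypothesis airr : irreflexive a.

(** The vertices of [S] are inserted one at a time. At most [2 * #|S| - 2] arcs of [w] stay inside
    [S], so more than [#|covered C|] join it to the covered part, and [w] alone has a slot. Each
    insertion raises [#|covered C|] by one and lowers [#|S|] by one, so the hypothesis survives. *)
Lemma absorb C S : packing C -> [disjoint covered C & S] ->
  (forall w, w \in S ->
     #|covered C| + 2 * #|S| <= (outin a w (covered C :|: S) + inin a w (covered C :|: S)).+1) ->
  exists C', [/\ packing C', covered C' = covered C :|: S & forall j, {subset C j <= C' j}].
Proof.
have [n] := ubnP #|S|; elim: n C S => // n IH C S Sn pC dCS hS.
have [->|[w wS]] := set_0Vmem S; first by exists C; split=> [//||j x //]; rewrite setU0.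
have wC : w \notin covered C by rewrite (disjointFl dCS wS).
have S1 : 0 < #|S| by apply/card_gt0P; exists w.
have [p [pc apw aws]] : exists p, [/\ p \in covered C, a p w & a w (succ C p)].
  apply: NNPP => no.
  have : inin a w (covered C) + outin a w (covered C) <= #|covered C|.
    apply: slot_count_covered => // p pc apw; apply/negP=> aws; apply: no; by exists p.
  have := hS _ wS; rewrite outinU // ininU //.
  have := outin_self airr wS; have := inin_self airr wS; lia.
have [j pj] := coveredP _ _ pc.
have [] := @ins_spec C j p w [::] pC pj isT isT _ apw aws.
  by move=> z; rewrite inE => /eqP->.
set C1 := ins C j p [:: w] => pC1 mC1 cC1.
have cC1' : covered C1 = w |: covered C.
  by rewrite cC1 setUC; congr setU; apply/setP=> z; rewrite !inE.
have E : covered C1 :|: S :\ w = covered C :|: S.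
  apply/setP=> z; rewrite cC1' !in_setU in_set1 in_setD1.
  by have [->|] := eqVneq z w; rewrite ?wS ?orbT.
have cS : #|S| = #|S :\ w|.+1 by rewrite (cardsD1 w S) wS.
have cC : #|covered C1| = #|covered C|.+1 by rewrite cC1' cardsU1 wC.
have [||||C' [pC' cC' sC']] := IH C1 (S :\ w).
- by lia.
- by [].
- rewrite disjoints_subset; apply/subsetP=> z; rewrite cC1' in_setU1 in_setC in_setD1.
  by case/orP=> [->//|zc]; rewrite (disjointFr dCS zc) andbF.
- move=> z /setD1P[_ zS]; rewrite E; have := hS _ zS; lia.
exists C'; split=> [//||i z zi]; first by rewrite cC' E.
by apply: sC'; rewrite mC1 zi.
Qed.

End Index.
End Packing.

(** * Stuck packings *)

Section Stuck.
Variables (V : finType) (a : rel V).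
Implicit Types (x y u v w p : V) (c s P G : seq V) (A B S : {set V}).

Definition woodall : Prop :=
  forall u v, u != v -> ~~ a u v -> #|V| <= outdeg a u + indeg a v.

(** The walk [x :: s] may repeat vertices, so that reachability in the uncovered part can be used
    directly; it can be shortened to a simple path with the same ends. *)
Definition stuck (I : finType) (C : I -> seq V) : Prop :=
  forall x s p, path a x s -> {in x :: s, forall z, z \notin covered C} ->
    p \in covered C -> a p x -> ~~ a (last x s) (succ C p).

Definition maximal (I : finType) (C : I -> seq V) : Prop :=
  forall C' : I -> seq V, packing a C' -> #|covered C'| <= #|covered C|.

Section Extend.
Variable I : finType.
Implicit Types C : I -> seq V.

Lemma card_covered_ins C x s : {in x :: s, forall z, z \notin covered C} ->
  #|covered C| < #|covered C :|: [set z in x :: s]|.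
Proof.
move=> dP; apply: proper_card; apply/properP; split; first exact: subsetUl.
exists x; last by apply: dP; rewrite mem_head.
by rewrite in_setU [x \in [set _ in _]]inE mem_head orbT.
Qed.

Lemma maximal_stuck C : packing a C -> maximal C -> stuck C.
Proof.
move=> pC mC x s p; case/shortenP=> s' ps us ss dP pc apx; apply/negP=> aly.
have [j pj] := coveredP _ _ pc.
have dP' : {in x :: s', forall z, z \notin covered C}.
  move=> z; rewrite inE => /predU1P[->|/ss zs]; apply: dP; rewrite ?mem_head //.
  by rewrite inE zs orbT.
have [pk _ cE] := ins_spec pC pj us ps dP' apx aly.
by have := mC _ pk; rewrite cE leqNgt card_covered_ins.
Qed.

Lemma maximal_exists C : packing a C -> exists C', packing a C' /\ maximal C'.
Proof.
have [n] := ubnP (#|V| - #|covered C|); elim: n C => // n IH C Cn pC.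
case: (classic (maximal C)) => [mC|nm]; first by exists C.
have [C' [pC' lt]] : exists C', packing a C' /\ #|covered C| < #|covered C'|.
  apply: NNPP => no; apply: nm => C' pC'; rewrite leqNgt; apply/negP=> lt.
  by apply: no; exists C'.
by apply: (IH C') => //; have := cardsC (covered C'); lia.
Qed.

(** Used where a packing must become stuck without losing the record of which vertices were
    inserted; replacing it by an unrelated maximal packing would destroy that record. Every
    insertion covers more, so the process stops. *)
Lemma stuck_extend (Q : (I -> seq V) -> Prop) :
  (forall C j p x s, packing a C -> Q C -> p \in C j -> uniq (x :: s) -> path a x s ->
     {in x :: s, forall z, z \notin covered C} -> a p x -> a (last x s) (succ C p) ->
     Q (ins C j p (x :: s))) ->
  forall C, packing a C -> Q C -> exists C', [/\ packing a C', Q C' & stuck C'].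
Proof.
move=> QI C; have [n] := ubnP (#|V| - #|covered C|); elim: n C => // n IH C Cn pC QC.
case: (classic (stuck C)) => [sC|ns]; first by exists C.
have [x [s [p [us ps [dP pc [apx aly]]]]]] : exists x s p, [/\ uniq (x :: s), path a x s &
    [/\ {in x :: s, forall z, z \notin covered C}, p \in covered C &
        a p x /\ a (last x s) (succ C p)]].
  apply: NNPP => no; apply: ns => x s p; case/shortenP=> s' ps us ss dP pc apx.
  apply/negP=> aly; apply: no; exists x, s', p; split=> //; split=> //.
  move=> z; rewrite inE => /predU1P[->|/ss zs]; apply: dP; rewrite ?mem_head //.
  by rewrite inE zs orbT.
have [j pj] := coveredP _ _ pc.
have [pk _ cE] := ins_spec pC pj us ps dP apx aly.
apply: (IH (ins C j p (x :: s))) => //; last exact: QI.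
have := card_covered_ins dP; rewrite -cE; have := cardsC (covered (ins C j p (x :: s))).
by lia.
Qed.

End Extend.

Hypotheses (airr : irreflexive a) (W : woodall).

Lemma card_ge2 A : 1 < #|A| -> exists x y, [/\ x \in A, y \in A & x != y].
Proof. by case/card_gt1P=> x [y [xA yA xy]]; exists x, y. Qed.

Section Rest.
Variables (I : finType) (C : I -> seq V).
Hypotheses (pC : packing a C) (sC : stuck C).
Local Notation H := (~: covered C).

Lemma card_rest : #|covered C| + #|H| = #|V|.
Proof. by rewrite cardsC. Qed.

Let eH : rel V := fun x y => [&& a x y, x \in H & y \in H].

Lemma connect_rest x y : x \in H -> connect eH x y ->
  exists s, [/\ path a x s, y = last x s & {in x :: s, forall z, z \notin covered C}].
Proof.
move=> xH /connectP[s ps ->]; exists s; split=> //.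
  by apply: sub_path ps => u v /and3P[].
move=> z; rewrite inE => /predU1P[->|zs]; first by rewrite -in_setC.
elim: s x {xH} ps zs => //= y' s IH x /andP[/and3P[_ _ yH] ps].
by rewrite inE => /predU1P[->|]; [rewrite -in_setC | exact: IH ps].
Qed.

Lemma connect_in x y : x \in H -> connect eH x y -> y \in H.
Proof.
move=> xH /(connect_rest xH)[s [_ -> dP]]; rewrite in_setC; apply: dP; exact: mem_last.
Qed.

Lemma connect_slot x y : x \in H -> connect eH x y ->
  inin a x (covered C) + outin a y (covered C) <= #|covered C|.
Proof.
move=> xH /(connect_rest xH)[s [ps -> dP]]; apply: (slot_count_covered pC) => p.
exact: sC.
Qed.

(** If [y] did not reach [x], the out-neighbours of [y] in [H] would lie in the set [A] reachable
    from [y], and the in-neighbours of [x] in the disjoint set [B] that reaches [x]. Together with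
    the slot count for a path from [x] to [y], the nonarc [(y, x)] would have degree sum at most
    [#|V| - 2]. *)
Lemma rest_connect_sym x y : x \in H -> connect eH x y -> connect eH y x.
Proof.
move=> xH xy; have yH := connect_in xH xy; apply: contraT => nyx.
pose A := [set z in H | connect eH y z]; pose B := [set z in H | connect eH z x].
have sA : A \subset H by apply/subsetP=> z; rewrite inE => /andP[].
have sB : B \subset H by apply/subsetP=> z; rewrite inE => /andP[].
have yA : y \in A by rewrite inE yH connect0.
have xB : x \in B by rewrite inE xH connect0.
have AB : #|A| + #|B| <= #|H|.
  rewrite -cardsUI (_ : A :&: B = set0) ?cards0 ?addn0.
    by apply: subset_leq_card; rewrite subUset sA.
  apply/setP=> z; rewrite !inE; apply/negP=> /andP[/andP[_ yz] /andP[_ zx]].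
  by rewrite (connect_trans yz zx) in nyx.
have o1 : outin a y H = outin a y A.
  rewrite (outinD _ _ sA) [X in X + _]outin0 // => z; rewrite in_setD => /andP[zA zH].
  apply: contra zA => ayz; rewrite inE zH connect1 //; exact/and3P.
have i1 : inin a x H = inin a x B.
  rewrite (ininD _ _ sB) [X in X + _]inin0 // => z; rewrite in_setD => /andP[zB zH].
  apply: contra zB => azx; rewrite inE zH connect1 //; exact/and3P.
have xy' : y != x by apply: contraNneq nyx => ->; exact: connect0.
have nayx : ~~ a y x by apply: contra nyx => ayx; rewrite connect1 //; apply/and3P.
have := W xy' nayx; rewrite (outdegC a y (covered C)) (indegC a x (covered C)) o1 i1.
have := outin_self airr yA; have := inin_self airr xB; have := connect_slot xH xy.
have := card_rest; lia.
Qed.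

(** By symmetry of reachability, distinct strong components would have no arcs between them. The two
    nonarcs between [x] and [y] would then have total degree sum at most [2 * #|V| - 4], each vertex
    alone being a path without a slot. *)
Lemma rest_strong x y : x \in H -> y \in H -> connect eH x y.
Proof.
move=> xH yH; apply: contraT => nxy.
have nyx : ~~ connect eH y x by apply: contra nxy; apply: rest_connect_sym.
pose A z := [set w in H | connect eH z w].
have sA z : A z \subset H by apply/subsetP=> w; rewrite inE => /andP[].
have zA z : z \in H -> z \in A z by move=> zH; rewrite inE zH connect0.
have AB : #|A x| + #|A y| <= #|H|.
  rewrite -cardsUI (_ : A x :&: A y = set0) ?cards0 ?addn0.
    by apply: subset_leq_card; rewrite subUset !sA.
  apply/setP=> z; rewrite !inE; apply/negP=> /andP[/andP[_ xz] /andP[_ yz]].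
  by rewrite (connect_trans xz (rest_connect_sym yH yz)) in nxy.
have o1 z : z \in H -> outin a z H = outin a z (A z).
  move=> zH; rewrite (outinD _ _ (sA z)) [X in X + _]outin0 // => w; rewrite in_setD => /andP[wA wH].
  apply: contra wA => azw; rewrite inE wH connect1 //; exact/and3P.
have i1 z : z \in H -> inin a z H = inin a z (A z).
  move=> zH; rewrite (ininD _ _ (sA z)) [X in X + _]inin0 // => w; rewrite in_setD => /andP[wA wH].
  apply: contra wA => azw; rewrite inE wH rest_connect_sym // connect1 //; exact/and3P.
have xy : x != y by apply: contraNneq nxy => ->; exact: connect0.
have naxy : ~~ a x y by apply: contra nxy => e; rewrite connect1 //; apply/and3P.
have nayx : ~~ a y x by apply: contra nyx => e; rewrite connect1 //; apply/and3P.
have yx : y != x by rewrite eq_sym.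
have := W xy naxy; have := W yx nayx.
rewrite !(outdegC a _ (covered C)) !(indegC a _ (covered C)) !o1 // !i1 //.
have := outin_self airr (zA _ xH); have := inin_self airr (zA _ xH).
have := outin_self airr (zA _ yH); have := inin_self airr (zA _ yH).
have := connect_slot xH (connect0 _ _); have := connect_slot yH (connect0 _ _).
have := card_rest; lia.
Qed.

Lemma rest_no_slot x y p : x \in H -> y \in H -> p \in covered C -> a p x -> ~~ a y (succ C p).
Proof.
move=> xH yH pc apx; have [s [ps -> dP]] := connect_rest xH (rest_strong xH yH).
exact: sC.
Qed.

Lemma rest_slot_count x y : x \in H -> y \in H ->
  inin a x (covered C) + outin a y (covered C) <= #|covered C|.
Proof. by move=> xH yH; apply: connect_slot => //; apply: rest_strong. Qed.

(** Strong connectivity gives a path from [y] to [x]; its slot count is subtracted from the degree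
    condition for [(x, y)]. *)
Lemma rest_woodall x y : x \in H -> y \in H -> x != y -> ~~ a x y ->
  #|H| <= outin a x H + inin a y H.
Proof.
move=> xH yH xy naxy; have := W xy naxy; have := rest_slot_count yH xH.
rewrite (outdegC a x (covered C)) (indegC a y (covered C)); have := card_rest; lia.
Qed.

(** Both neighbourhoods avoid [x] and [y], so inclusion-exclusion leaves at least two common
    vertices. *)
Lemma rest_common x y : x \in H -> y \in H -> x != y -> ~~ a x y ->
  1 < #|[set z in H | a x z && a z y]|.
Proof.
move=> xH yH xy naxy; have := rest_woodall xH yH xy naxy.
rewrite /outin /inin -cardsUI.
have -> : [set u in H | a x u] :&: [set u in H | a u y] = [set z in H | a x z && a z y].
  by apply/setP=> z; rewrite in_setI !in_set; do 2?case: (a _ _); rewrite /= ?andbF ?andbT ?andbb.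
suff : #|[set u in H | a x u] :|: [set u in H | a u y]| + 2 <= #|H| by lia.
have <- : #|[set x; y]| = 2 by rewrite cards2 xy.
rewrite -[leqRHS](cardsID [set x; y]) addnC leq_add ?subset_leq_card //.
  by apply/subsetP=> z /set2P[]->; rewrite in_setI ?set21 ?set22 ?xH ?yH.
apply/subsetP=> z; rewrite in_setD in_set2 in_setU !in_set -andb_orr => /andP[-> h].
rewrite andbT; apply/norP; split; apply: contraTneq h => ->; rewrite ?airr /=; last by rewrite orbF.
by [].
Qed.

(** The nonarc is recorded for paths of three vertices because it pays for the extra vertex in the
    count of [bridge_augment]. *)
Lemma rest_short_path x y : x \in H -> y \in H -> x != y ->
  exists s, [/\ path a x s, last x s = y, uniq (x :: s), {in x :: s, forall z, z \in H} &
     size s = 1 \/ size s = 2 /\ ~~ a x y].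
Proof.
move=> xH yH xy; case: (boolP (a x y)) => axy.
  exists [:: y]; split=> //=; rewrite ?axy ?inE ?xy //; last by left.
  by move=> z; rewrite in_cons mem_seq1 => /orP[]/eqP->.
have /ltnW/card_gt0P[z] := rest_common xH yH xy axy; rewrite inE => /and3P[zH axz azy].
exists [:: z; y]; split=> //=; rewrite ?axz ?azy ?inE //.
- rewrite negb_or xy andbT /=; apply/andP; split.
    by apply: contraTneq axz => ->; rewrite airr.
  by rewrite andbT; apply: contraTneq azy => ->; rewrite airr.
- by move=> w; rewrite 2!in_cons mem_seq1 => /or3P[]/eqP->.
- by right.
Qed.

Definition into_rest := [set p in covered C | [exists x in H, a p x]].
Definition from_rest := [set p in covered C | [exists x in H, a x p]].

Lemma into_restP p : reflect (p \in covered C /\ exists2 x, x \in H & a p x) (p \in into_rest).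
Proof.
rewrite [p \in into_rest]inE; apply: (iffP andP) => -[-> h]; split=> //.
  by have [x xH apx] := exists_inP h; exists x.
by apply/exists_inP; case: h => x; exists x.
Qed.
Lemma from_restP p : reflect (p \in covered C /\ exists2 x, x \in H & a x p) (p \in from_rest).
Proof.
rewrite [p \in from_rest]inE; apply: (iffP andP) => -[-> h]; split=> //.
  by have [x xH apx] := exists_inP h; exists x.
by apply/exists_inP; case: h => x; exists x.
Qed.

Lemma into_from p : p \in into_rest -> succ C p \notin from_rest.
Proof.
case/into_restP=> pc [x xH apx]; apply/negP=> /from_restP[_ [y yH ay]].
by have := rest_no_slot xH yH pc apx; rewrite ay.
Qed.

(** Otherwise a covered [p] and an uncovered [x] form a nonarc for which only out-arcs of [p] within
    [covered C] and in-arcs of [x] within [H] count, at most [#|V| - 2] in all. *)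
Lemma into_rest_neq0 : 0 < #|covered C| -> 0 < #|H| -> exists p, p \in into_rest.
Proof.
case/card_gt0P=> p pc /card_gt0P[x xH]; case: (set_0Vmem into_rest) => [E|[q]]; last by exists q.
have nx y : y \in H -> ~~ a p y.
  move=> yH; apply/negP=> apy; have : p \in into_rest by apply/into_restP; split=> //; exists y.
  by rewrite E inE.
have px : p != x by apply: contraTneq pc => ->; rewrite -in_setC.
have := W px (nx _ xH); rewrite (outdegC a p (covered C)) (indegC a x (covered C)) (outin0 nx).
have := outin_self airr pc; have := inin_self airr xH; rewrite [inin a x (covered C)]inin0.
  have := card_rest; lia.
move=> q qc; apply/negP=> aqx; have : q \in into_rest by apply/into_restP; split=> //; exists x.
by rewrite E inE.
Qed.

Lemma from_rest_neq0 : 0 < #|covered C| -> 0 < #|H| -> exists p, p \in from_rest.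
Proof.
case/card_gt0P=> p pc /card_gt0P[x xH]; case: (set_0Vmem from_rest) => [E|[q]]; last by exists q.
have nx y : y \in H -> ~~ a y p.
  move=> yH; apply/negP=> apy; have : p \in from_rest by apply/from_restP; split=> //; exists y.
  by rewrite E inE.
have px : x != p by apply: contraTneq pc => <-; rewrite -in_setC.
have := W px (nx _ xH); rewrite (outdegC a x (covered C)) (indegC a p (covered C)) (inin0 nx).
have := inin_self airr pc; have := outin_self airr xH; rewrite [outin a x (covered C)]outin0.
  have := card_rest; lia.
move=> q qc; apply/negP=> aqx; have : q \in from_rest by apply/from_restP; split=> //; exists x.
by rewrite E inE.
Qed.

End Rest.
End Stuck.

(** * Trading an arc of a cycle for uncovered vertices *)

Section Replace.
Variables (V : finType) (a : rel V).
Hypotheses (airr : irreflexive a) (W : woodall a).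
Implicit Types (x y u v w p o : V) (c s P G R : seq V) (A B S : {set V}).
Variable I : finType.
Implicit Types (C : I -> seq V) (i j : I).

Lemma mem_rot_eq n c d : rot n c = d -> c =i d.
Proof. by move=> <- z; rewrite mem_rot. Qed.

(** The image of [A] under [succ C], the set [B] and [behead G] are pairwise disjoint: a vertex of
    [G] other than the first has its predecessor in [G], hence outside [A]. The first one follows
    [o], which may lie in [A]; this costs the one in [(size G).-1]. *)
Lemma gap_count C j n o G R A B : packing a C -> rot n (C j) = o :: G ++ R ->
  A \subset covered C -> B \subset covered C -> (forall p, p \in A -> succ C p \notin B) ->
  {in G, forall w, w \notin A /\ w \notin B} ->
  #|A| + #|B| + (size G).-1 <= #|covered C|.
Proof.
move=> pC E sA sB AB hG.
have U : uniq (o :: G ++ R) by rewrite -E rot_uniq (packing_uniq _ pC).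
have Gj z : z \in G -> z \in C j.
  by move=> zG; rewrite (mem_rot_eq E) inE mem_cat zG orbT.
have UG : uniq (behead G).
  by move: U => /= /andP[_]; rewrite cat_uniq => /and3P[+ _ _]; case: (G) => //= g l /andP[].
rewrite -(card_imset A (succ_inj pC)) -size_behead -(card_uniqP UG) -[#|behead G|]cardsE.
rewrite -[#|_| + #|B|]cardsUI (_ : _ :&: B = set0) ?cards0 ?addn0; last first.
  apply/setP=> z; rewrite in_set0 in_setI; apply/negP=> /andP[/imsetP[q qA ->]].
  by rewrite (negbTE (AB _ qA)).
rewrite -cardsUI (_ : _ :&: [set x in behead G] = set0) ?cards0 ?addn0.
  apply/subset_leq_card/subsetP=> z; rewrite !in_setU => /orP[/orP[/imsetP[q /(subsetP sA)qA ->]|/(subsetP sB)//]|].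
    by rewrite (succ_covered _ pC).
  by rewrite inE => /mem_behead/Gj; apply: mem_covered.
apply/setP=> z; rewrite in_set0 in_setI in_setU [z \in [set _ in behead G]]inE.
apply/negP=> /andP[+ zG] => /orP[/imsetP[q qA ez]|zB]; last first.
  by case: (hG z (mem_behead zG)) => _; rewrite zB.
case: G zG hG E U Gj {UG} => //= g G; case/splitPr=> p1 p2 hG E U Gj.
have lg : last g p1 \in C j by apply: Gj; rewrite -cat_cons mem_cat mem_last.
have El : o :: g :: (p1 ++ z :: p2) ++ R =
    (o :: belast g p1) ++ last g p1 :: z :: (p2 ++ R).
  by rewrite -[_ :: z :: _]cat1s cat_cons catA cats1 -lastI -catA.
have ss : succ C (last g p1) = z.
  rewrite (succ_rot pC lg E) El; apply: next_cat_cons; rewrite -El; exact: U.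
have := hG (last g p1); rewrite -cat_cons mem_cat mem_last => /(_ isT)[+ _].
by rewrite (succ_inj pC (etrans ss ez)) qA.
Qed.

(** The path takes the place of [G] on its cycle, and [absorb] puts the vertices of [G] back. The
    size condition says that the new cycle [o :: x :: s ++ R] has at least three vertices. If [R] is
    empty, [head o R] is [o] and the cycle closes up at [o] itself. *)
Lemma gap_replace C j n o G R x s : packing a C -> rot n (C j) = o :: G ++ R ->
  uniq (x :: s) -> path a x s -> {in x :: s, forall z, z \notin covered C} ->
  a o x -> a (last x s) (head o R) -> 1 < size s + size R + 1 ->
  {in G, forall w, #|covered C| + size (x :: s) + size G <=
    (outin a w (covered C :|: [set z in x :: s]) +
     inin a w (covered C :|: [set z in x :: s])).+1} ->
  exists C', [/\ packing a C', covered C' = covered C :|: [set z in x :: s],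
    (forall i, i != j -> {subset C i <= C' i}) & {subset x :: s <= C' j}].
Proof.
set P := x :: s => pC E uP ps dP aox aly sz hG.
have Uj : uniq (o :: G ++ R) by rewrite -E rot_uniq (packing_uniq _ pC).
have Ej : C j =i o :: G ++ R := mem_rot_eq E.
have mjE z : (z \in C j) = (z \in G) || (z \in o :: R).
  by rewrite Ej in_cons mem_cat orbCA -in_cons.
have UG : uniq G by move: Uj => /= /andP[_]; rewrite cat_uniq => /and3P[].
have dGR z : z \in G -> z \notin o :: R.
  move=> zG; move: Uj => /= /andP[oGR]; rewrite cat_uniq => /and3P[_ hGR _].
  rewrite inE negb_or; apply/andP; split.
    by apply: contraNneq oGR => <-; rewrite mem_cat zG.
  by apply: contra hGR => zR; apply/hasP; exists z.
have cy : cycle a (o :: G ++ R) by rewrite -E rot_cycle (packing_cycle _ pC).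
have Pj z : z \in P -> z \notin C j.
  by move=> /dP; apply: contra; apply: mem_covered.
pose c := o :: P ++ R.
have mc z : (z \in c) = (z \in o :: R) || (z \in P).
  by rewrite inE mem_cat in_cons orbCA orbA [in RHS]orbC orbA.
have gc : long_cycle a c.
  apply/and3P; split; first by rewrite /= size_cat; lia.
    have [/andP[oGR UR]] : (o \notin G ++ R) && uniq (G ++ R) by [].
    move: UR oGR; rewrite cat_uniq mem_cat negb_or => /and3P[_ _ UR] /andP[_ oR].
    have oP : o \notin P by apply/negP=> /Pj; rewrite Ej mem_head.
    rewrite /c cons_uniq mem_cat (negbTE oP) (negbTE oR) cat_uniq uP UR andbT andTb.
    by apply/hasPn=> z zR; apply/negP=> /Pj; rewrite Ej inE mem_cat zR !orbT.
  rewrite /c /= aox rcons_cat cat_path ps /=.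
  case: (R) aly cy => [|r R'] /=; first by move=> ->.
  by move=> -> ; rewrite rcons_cat cat_path /= => /andP[_ /andP[_]].
pose C1 := upd C j c.
have pC1 : packing a C1.
  apply: upd_packing => // i z ij; rewrite mc => /orP[zR|/dP]; last first.
    by apply: contra; apply: mem_covered.
  have zj : z \in C j.
    by rewrite Ej; move: zR; rewrite !inE mem_cat => /orP[->|->]; rewrite ?orbT.
  by apply: contra ij => zi; case: pC => _ dC; rewrite (dC _ _ _ zi zj).
have cC1 : covered C1 = (covered C :\: [set z in C j]) :|: [set z in c] by apply: (covered_upd _ _ pC).
have mC1 z : (z \in covered C1) = (z \in covered C) && (z \notin G) || (z \in P).
  rewrite cC1 in_setU in_setD [z \in [set _ in C j]]inE [z \in [set _ in c]]inE mc.
  rewrite mjE.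
  case zG: (z \in G); first by rewrite (negbTE (dGR _ zG)) andbF.
  case zR: (z \in o :: R) => /=; last by rewrite andbT.
  by rewrite (mem_covered (i := j)) // mjE zR orbT.
pose Gs := [set z in G].
have GsE : #|Gs| = size G by rewrite cardsE; apply/card_uniqP.
have Gc z : z \in G -> z \in covered C.
  by move=> zG; rewrite (mem_covered (i := j)) // Ej inE mem_cat zG orbT.
have dis : [disjoint covered C1 & Gs].
  rewrite disjoints_subset; apply/subsetP=> z; rewrite mC1 in_setC [z \in Gs]inE.
  by case/orP=> [/andP[]//|/dP]; apply: contra; apply: Gc.
have Un : covered C1 :|: Gs = covered C :|: [set z in P].
  apply/setP=> z; rewrite !in_setU mC1 [z \in Gs]inE [z \in [set _ in P]]inE.
  by case zG: (z \in G) => /=; rewrite ?(Gc _ zG) ?orbT ?andbT ?orbF.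
have cd : #|covered C1| + size G = #|covered C| + size P.
  rewrite -GsE -cardsUI Un (_ : _ :&: Gs = set0); last by apply/eqP; rewrite setI_eq0.
  rewrite cards0 addn0 cardsU (_ : _ :&: _ = set0) ?cards0 ?subn0.
    by congr addn; rewrite cardsE; apply/card_uniqP.
  apply/setP=> z; rewrite in_setI in_set0 [z \in [set _ in P]]inE.
  by apply/negP=> /andP[zc /dP]; rewrite zc.
have [|C' [pC' cC' sC']] := absorb airr pC1 dis.
  by move=> w; rewrite inE => wG; rewrite Un GsE; have := hG _ wG; lia.
exists C'; split=> //; first by rewrite cC'.
  by move=> i ij z zi; apply: sC'; rewrite /C1 upd_neq.
by move=> z zP; apply: sC'; rewrite /C1 upd_eq mc zP orbT.
Qed.

Lemma split_cycle C j u v A B : packing a C -> u \in C j -> v \in C j -> u != v ->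
  u \in A -> v \in B ->
  exists n o G w R, [/\ rot n (C j) = o :: G ++ w :: R, o \in A, w \in B &
     {in G, forall w, w \notin A /\ w \notin B}].
Proof.
move=> pC uj vj uv uA vB; have [r Er _] := rot_to_head (packing_uniq j pC) uj.
have vr : v \in r.
  have : v \in u :: r by rewrite -(mem_rot_eq Er).
  by rewrite inE eq_sym (negbTE uv).
case/splitPr: vr Er => X Y Er.
have [A' [o [G [i [B' [E oA iB aG]]]]]] := @tight_pair _ (mem A) (mem B) u v X uA vB.
have Er2 : rot (index u (C j)) (C j) = A' ++ (o :: G ++ i :: B' ++ Y).
  by rewrite Er -cat_rcons -cat_cons E -catA /= -catA.
have iu : index u (C j) <= size (C j) by rewrite index_size.
have sA : size A' <= size (C j) by rewrite -(size_rot (index u (C j)) (C j)) Er2 size_cat /=; lia.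
have [k Ek] : exists k, rot k (C j) = o :: G ++ i :: B' ++ Y ++ A'.
  have -> : o :: G ++ i :: B' ++ Y ++ A' = rot (size A') (rot (index u (C j)) (C j)).
    by rewrite Er2 rot_size_cat /= -!catA /= -!catA.
  by rewrite rot_add_mod //; eexists.
by exists k, o, G, i, (B' ++ Y ++ A'); split=> // w /(allP aG)/andP.
Qed.

End Replace.

Section Augment.
Variables (V : finType) (a : rel V).
Hypotheses (airr : irreflexive a) (W : woodall a).
Implicit Types (x y u v w p o t : V) (c s P G R : seq V) (A B S : {set V}).

Lemma woodall2 u v : u != v -> ~~ a u v -> ~~ a v u ->
  2 * #|V| <= outdeg a u + indeg a u + (outdeg a v + indeg a v).
Proof.
move=> uv nuv nvu; have vu : v != u by rewrite eq_sym.
have := W uv nuv; have := W vu nvu; lia.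
Qed.

Lemma outdeg_in v A : (forall x, x \notin A -> ~~ a v x) -> outdeg a v = outin a v A.
Proof.
move=> h; rewrite (outdegC a v A) [X in _ + X]outin0 ?addn0 // => x; rewrite in_setC.
exact: h.
Qed.
Lemma indeg_in v A : (forall x, x \notin A -> ~~ a x v) -> indeg a v = inin a v A.
Proof.
move=> h; rewrite (indegC a v A) [X in _ + X]inin0 ?addn0 // => x; rewrite in_setC.
exact: h.
Qed.

Section Index.
Variable I : finType.
Implicit Types (C : I -> seq V) (i j : I).

(** Between a tight pair on cycle [j] the gap is nonadjacent to the uncovered part and is exchanged
    for an uncovered path of at most three vertices. For a gap vertex [g], [woodall2] is applied to
    [g] and [x], and [gap_count] bounds the degree of [x]; hence [g] has degree at least
    [#|covered C| + size G + 1], enough to be absorbed if the path has at most two vertices. A third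
    vertex needs one more, which the nonarc [(x, y)] provides. *)
Lemma bridge_augment C j u v : packing a C -> stuck a C -> u \in C j -> v \in C j -> u != v ->
  u \in into_rest a C -> v \in from_rest a C ->
  exists C' x s, [/\ packing a C', {in x :: s, forall z, z \notin covered C},
    covered C' = covered C :|: [set z in x :: s],
    (forall i, i != j -> {subset C i <= C' i}) & {subset x :: s <= C' j}].
Proof.
move=> pC sC uj vj uv uO vI.
have [n [o [G [w [R [E oO wI hG]]]]]] := split_cycle pC uj vj uv uO vI.
have [_ [x xH aox]] := into_restP _ _ _ oO.
have [_ [y yH ayw]] := from_restP _ _ _ wI.
have [s [ps ls us hs sz]] : exists s, [/\ path a x s, last x s = y, uniq (x :: s),
    {in x :: s, forall z, z \in ~: covered C} &
    size s <= 1 \/ [/\ size s = 2, x != y & ~~ a x y]].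
  have [xy|xy] := eqVneq x y.
    by exists [::]; split=> //; [move=> z; rewrite mem_seq1 => /eqP-> | left].
  have [s [ps ls us hs sz]] := rest_short_path airr W pC sC xH yH xy.
  by exists s; split=> //; case: sz => [->|[-> ?]]; [left | right].
have dP : {in x :: s, forall z, z \notin covered C} by move=> z /hs; rewrite in_setC.
suff [C' [pC' cC' oC' jC']] : exists C', [/\ packing a C',
    covered C' = covered C :|: [set z in x :: s],
    (forall i, i != j -> {subset C i <= C' i}) & {subset x :: s <= C' j}].
  by exists C', x, s.
apply: (gap_replace airr pC E us ps dP aox _ _) => /=; first by rewrite ls.
  by rewrite addn1 addnS.
move=> g gG; have [gO gI] := hG _ gG.
have sPH : [set z in x :: s] \subset ~: covered C.
  by apply/subsetP=> z; rewrite inE; apply: hs.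
have gc : g \in covered C.
  by rewrite (mem_covered (i := j)) // (mem_rot_eq E) inE mem_cat gG orbT.
have ng z : z \in ~: covered C -> ~~ a g z.
  by move=> zH; apply: contra gO => agz; apply/into_restP; split=> //; exists z.
have gn z : z \in ~: covered C -> ~~ a z g.
  by move=> zH; apply: contra gI => agz; apply/from_restP; split=> //; exists z.
rewrite -outdeg_in; last first.
  by move=> z; rewrite in_setU negb_or => /andP[zc _]; apply: ng; rewrite in_setC.
rewrite -indeg_in; last first.
  by move=> z; rewrite in_setU negb_or => /andP[zc _]; apply: gn; rewrite in_setC.
have gx : g != x by apply: contraTneq gc => ->; rewrite -in_setC.
have := woodall2 gx (ng _ xH) (gn _ xH).
have gap := gap_count pC E _ _ (into_from airr W pC sC) hG.
have {gap} gap : #|into_rest a C| + #|from_rest a C| + (size G).-1 <= #|covered C|.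
  by apply: gap; apply/subsetP=> z; rewrite inE => /andP[].
have G1 : 0 < size G by case: (G) gG.
have ox : outin a x (covered C) <= #|from_rest a C|.
  apply/subset_leq_card/subsetP=> z; rewrite [z \in [set _ in _ | _]]inE => /andP[zc az].
  by apply/from_restP; split=> //; exists x.
have ix : inin a x (covered C) <= #|into_rest a C|.
  apply/subset_leq_card/subsetP=> z; rewrite [z \in [set _ in _ | _]]inE => /andP[zc az].
  by apply/into_restP; split=> //; exists x.
rewrite (outdegC a x (covered C)) (indegC a x (covered C)).
have := card_rest C; have := inin_self airr xH; have := outin_self airr xH.
move: gap G1 ox ix.
case: sz => [|[+ xy nxy]]; first by rewrite /=; degree_lia.
by have := outin_self2 airr xH yH xy nxy; rewrite /=; degree_lia.
Qed.

End Index.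
End Augment.

(** * Woodall's theorem *)

Section Hamilton.
Variables (V : finType) (a : rel V).
Hypotheses (airr : irreflexive a) (W : woodall a).
Implicit Types (x y u v w p o t : V) (c s P G R : seq V) (A B S : {set V}).

Lemma card_gt1_neq A z : 1 < #|A| -> exists2 w, w \in A & w != z.
Proof.
case/card_gt1P=> x [y [xA yA xy]]; have [xz|xz] := eqVneq x z; last by exists x.
by exists y; rewrite // -xz eq_sym.
Qed.

(** The empty packing is stuck and leaves everything uncovered, so facts about the uncovered part
    apply to the whole digraph. *)
Lemma woodall_common x y : x != y -> ~~ a x y -> 1 < #|[set z | a x z && a z y]|.
Proof.
move=> xy naxy; pose C0 (i : void) : seq V := [::].
have pC : packing a C0 by split=> [[]|[]].
have c0 : covered C0 = set0.
  by apply/setP=> z; rewrite in_set0; apply/negP=> /coveredP[[]].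
have sC : stuck a C0 by move=> z s p _ _; rewrite c0 inE.
have := rest_common airr W pC sC _ _ xy naxy; rewrite c0 setC0 !in_setT => /(_ isT isT).
rewrite (_ : [set z in _ | _] = [set z | a x z && a z y]) //.
by apply/setP=> z; rewrite !inE.
Qed.

(** For a nonarc [(x, y)] take a path [x, z, y]: it is closed either by the arc from [y] to [x] or
    by a path [y, w, x] with [w != z]. If there is no nonarc, any three vertices form a triangle. *)
Lemma long_cycle_exists : 3 <= #|V| -> exists c, long_cycle a c.
Proof.
move=> V3.
have arcN u v : a u v -> u != v by apply: contraTneq => ->; rewrite airr.
case: (boolP [exists x, exists y, (x != y) && ~~ a x y]) => [|no]; last first.
  have all_arc x y : x != y -> a x y.
    move=> xy; apply: contraR no => nxy; apply/existsP; exists x; apply/existsP; exists y.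
    by rewrite xy.
  case: (enum V) (enum_uniq V) (cardE V) => [|x [|y [|z l]]]; rewrite ?V3 //= => U E;
    try by rewrite E in V3.
  exists [:: x; y; z]; move: U; rewrite !inE !negb_or => /and4P[/and3P[xy xz _] /andP[yz _] _ _].
  rewrite /long_cycle /= !inE !negb_or xy xz yz /= !all_arc // eq_sym //.
case/existsP=> x /existsP[y /andP[xy naxy]].
have c1 := woodall_common xy naxy.
have [z] : exists z, z \in [set z | a x z && a z y] by apply/card_gt0P; lia.
rewrite inE => /andP[axz azy]; case: (boolP (a y x)) => ayx.
  by exists [:: x; z; y]; rewrite /long_cycle /= !inE negb_or axz azy ayx xy !arcN.
have yx : y != x by rewrite eq_sym.
have [w] := card_gt1_neq z (woodall_common yx ayx).
rewrite inE => /andP[ayw awx] wz; exists [:: x; z; y; w].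
rewrite /long_cycle /= !inE !negb_or axz azy ayw awx xy !(arcN _ _ axz) (arcN _ _ azy) (arcN _ _ ayw).
by rewrite [x == w]eq_sym (arcN _ _ awx) [z == w]eq_sym wz.
Qed.

(** For a longest cycle that is not spanning, [bridge_augment] forces all arcs between the cycle and
    the rest to meet the cycle in one vertex [o]. Another cycle vertex [w] and an uncovered [x] are
    then nonadjacent, with total degree at most [2 * #|V| - 2]. *)
Theorem woodall_hamiltonian : 3 <= #|V| -> exists2 c, long_cycle a c & forall x, x \in c.
Proof.
case/long_cycle_exists=> c0 gc0; pose C0 (i : 'I_1) := c0.
have pC0 : packing a C0 by split=> // i j x _ _; rewrite !ord1.
have [C [pC mC]] := maximal_exists pC0.
have sC := maximal_stuck pC mC.
have [Hx|[x xH]] := set_0Vmem (~: covered C).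
  exists (C ord0); first by case: pC.
  move=> x; have : x \in covered C by rewrite -[x \in _]negbK -in_setC Hx inE.
  by case/coveredP=> i; rewrite ord1.
have H0 : 0 < #|~: covered C| by apply/card_gt0P; exists x.
have szC := packing_size ord0 pC.
have cC : covered C = [set z in C ord0].
  by apply/setP=> z; rewrite [RHS]inE; apply/coveredP/idP => [[i]|]; [rewrite ord1 | exists ord0].
have N3 : 2 < #|covered C| by rewrite cC cardsE (card_uniqP (packing_uniq ord0 pC)).
have Ngt : 0 < #|covered C| by lia.
have [o oO] := into_rest_neq0 airr W Ngt H0.
have [v vI] := from_rest_neq0 airr W Ngt H0.
have meq p q : p \in into_rest a C -> q \in from_rest a C -> p = q.
  move=> pO qI; apply/eqP; apply: contraT => pq.
  have pc : p \in C ord0 by have [] := into_restP _ _ _ pO; rewrite cC inE.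
  have qc : q \in C ord0 by have [] := from_restP _ _ _ qI; rewrite cC inE.
  have [C' [y [s [pC' dP cE _ _]]]] := bridge_augment airr W pC sC pc qc pq pO qI.
  by have := mC _ pC'; rewrite cE leqNgt card_covered_ins.
have eov := meq _ _ oO vI.
have [w wc wo] : exists2 w, w \in covered C & w != o by apply: card_gt1_neq; lia.
have xw : x != w by apply: contraTneq wc => <-; rewrite -in_setC.
have nxw : ~~ a x w.
  apply/negP=> axw; have wI : w \in from_rest a C by apply/from_restP; split=> //; exists x.
  by rewrite (meq _ _ oO wI) eqxx in wo.
have nwx : ~~ a w x.
  apply/negP=> axw; have wO : w \in into_rest a C by apply/into_restP; split=> //; exists x.
  by rewrite (meq _ _ wO vI) eov eqxx in wo.
have := woodall2 W xw nxw nwx.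
have [] : [/\ outin a x (covered C) <= 1, inin a x (covered C) <= 1,
    outin a w (~: covered C) = 0 & inin a w (~: covered C) = 0].
  split.
  - rewrite -[leqRHS](cards1 o).
    apply/subset_leq_card/subsetP=> z; rewrite [z \in [set _ in _ | _]]inE => /andP[zc az].
    by rewrite inE (meq o z) //; apply/from_restP; split=> //; exists x.
  - rewrite -[leqRHS](cards1 o).
    apply/subset_leq_card/subsetP=> z; rewrite [z \in [set _ in _ | _]]inE => /andP[zc az].
    by rewrite inE eov (meq z v) //; apply/into_restP; split=> //; exists x.
  - apply: outin0 => z zH; apply/negP=> az.
    have wO : w \in into_rest a C by apply/into_restP; split=> //; exists z.
    by rewrite (meq _ _ wO vI) eov eqxx in wo.
  - apply: inin0 => z zH; apply/negP=> az.
    have wI : w \in from_rest a C by apply/from_restP; split=> //; exists z.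
    by rewrite (meq _ _ oO wI) eqxx in wo.
rewrite !(outdegC a _ (covered C)) !(indegC a _ (covered C)).
have := outin_self airr xH; have := inin_self airr xH.
have := outin_self airr wc; have := inin_self airr wc.
have := card_rest C; lia.
Qed.

End Hamilton.

Section RestHamilton.
Variables (V : finType) (a : rel V).
Hypotheses (airr : irreflexive a) (W : woodall a).
Variables (I : finType) (C : I -> seq V).
Hypotheses (pC : packing a C) (sC : stuck a C).
Local Notation H := (~: covered C).

(** By [rest_woodall] the subdigraph induced on the uncovered part, taken as a subtype, satisfies
    the hypotheses of Woodall's theorem. *)
Lemma rest_hamiltonian : 3 <= #|H| -> exists2 c, long_cycle a c & c =i H.
Proof.
move=> H3; pose T := {x : V | x \in H}; pose b : rel T := fun x y => a (val x) (val y).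
have cT : #|{: T}| = #|H| by rewrite card_sig.
have bo (x : T) : outdeg b x = outin a (val x) H.
  rewrite /outdeg /outin -(card_imset _ val_inj); apply: eq_card => z.
  rewrite [RHS]inE; apply/imsetP/andP => [[y]|[zH az]].
    by rewrite inE => axy ->; split=> //; apply: valP.
  by exists (Sub z zH : T); rewrite ?inE /b !SubK.
have bi (x : T) : indeg b x = inin a (val x) H.
  rewrite /indeg /inin -(card_imset _ val_inj); apply: eq_card => z.
  rewrite [RHS]inE; apply/imsetP/andP => [[y]|[zH az]].
    by rewrite inE => axy ->; split=> //; apply: valP.
  by exists (Sub z zH : T); rewrite ?inE /b !SubK.
have birr : irreflexive b by move=> x; apply: airr.
have bW : woodall b.
  move=> u v uv nuv; rewrite cT bo bi; apply: (rest_woodall airr W pC sC) => //; exact: valP.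
have [|c /and3P[szc uc cc] mc] := woodall_hamiltonian birr bW; first by rewrite cT.
exists (map val c).
  rewrite /long_cycle size_map szc (map_inj_uniq val_inj) uc /=.
  by move: cc; case: (c) => //= x l; rewrite -map_rcons path_map.
move=> z; apply/mapP/idP => [[x _ ->]|zH]; first exact: valP.
by exists (Sub z zH : T); rewrite ?mc // SubK.
Qed.

Lemma rest_ham_path t : t \in H ->
  exists x s, [/\ path a x s, last x s = t, uniq (x :: s) & x :: s =i H].
Proof.
move=> tH; have H1 : 0 < #|H| by apply/card_gt0P; exists t.
case: (leqP 3 #|H|) => [/rest_hamiltonian[c /and3P[_ uc cc] mc]|H2].
  have tc : t \in c by rewrite mc.
  have [r Er _] := rot_to_head uc tc.
  have mr := mem_rot_eq Er; have : cycle a (t :: r) by rewrite -Er rot_cycle.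
  have : uniq (t :: r) by rewrite -Er rot_uniq.
  case: r mr {Er} => [|y r] mr U.
    by move=> _; exists t, [::]; split=> // z; rewrite -mr mc.
  rewrite (_ : cycle _ _ = a t y && path a y (rcons r t)) // => /andP[_ pr].
  exists y, (rcons r t); split=> //; first by rewrite last_rcons.
    by rewrite -rcons_cons -rot1_cons rot_uniq.
  by move=> z; rewrite -rcons_cons -rot1_cons mem_rot -mr mc.
have [E|] := eqVneq #|H| 1.
  have /cards1P[z E1] : #|H| == 1 by rewrite E.
  exists t, [::]; split=> // z'; move: tH; rewrite E1 mem_seq1 !in_set1 => /eqP->.
  by [].
move=> ne; have H22 : 1 < #|H| by lia.
have [x xH xt] := card_gt1_neq t H22.
have E2 : [set x; t] = H.
  apply/eqP; rewrite eqEcard cards2 xt subUset !sub1set xH tH /=; lia.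
have [s [ps ls us hs sz]] := rest_short_path airr W pC sC xH tH xt.
exists x, s; split=> // z; apply/idP/idP => [/hs //|].
rewrite -E2 => /set2P[]->; first exact: mem_head.
by rewrite -ls mem_last.
Qed.

End RestHamilton.

(** * Covering one or two remaining vertices *)

Definition has_factor (V : finType) (a : rel V) (I : finType) : Prop :=
  exists C : I -> seq V, packing a C /\ covered C = setT.

Lemma card_set_seq (T : finType) (s : seq T) : uniq s -> #|[set z in s]| = size s.
Proof. by move=> us; rewrite cardsE; apply/card_uniqP. Qed.

Lemma in_sep (T : finType) (A : {set T}) (Q : pred T) x :
  (x \in [set p in A | Q p]) = (x \in A) && Q x.
Proof. by rewrite inE. Qed.

Lemma split_first (T : eqType) (b : pred T) (F : seq T) : has b F ->
  exists F1 z F2, [/\ F = F1 ++ z :: F2, b z & {in F1, forall w, ~~ b w}].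
Proof.
elim: F => //= z F IH; case: (boolP (b z)) => [bz _|nz /= /IH]; first by exists [::], z, F.
case=> F1 [v [F2 [-> bv h]]]; exists (z :: F1), v, F2; split=> // w.
by rewrite inE => /predU1P[->|/h].
Qed.

Section Close.
Variables (V : finType) (a : rel V).
Hypotheses (airr : irreflexive a) (W : woodall a).
Implicit Types (x y u v w p o t : V) (c s P G R : seq V) (A B S : {set V}).
Variable I : finType.
Implicit Types (C : I -> seq V) (i j : I).

(* The degree sum of e := last v R and x cannot be reached among the uncovered vertices, so
   the path from x to e has a slot. *)
Lemma splice C x s v R : packing a C -> uniq (x :: s ++ v :: R) -> path a x (s ++ v :: R) ->
  {in x :: s ++ v :: R, forall z, z \notin covered C} -> ~~ a (last v R) x ->
  outin a (last v R) [set z in x :: s] + inin a x (~: covered C :\: [set z in x :: s]) <= 1 ->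
  exists C', packing a C' /\ covered C' = covered C :|: [set z in x :: s ++ v :: R].
Proof.
set e := last v R => pC uQ pQ dQ nex le1.
set P := [set z in x :: s] in le1 *.
have eT : e \in ~: covered C :\: P.
  rewrite in_setD in_setC dQ ?andbT; last by rewrite -cat_cons mem_cat mem_last orbT.
  rewrite inE; move: uQ; rewrite -cat_cons cat_uniq => /and3P[_ /hasPn h _].
  by apply: h; rewrite mem_last.
have xP : x \in P by rewrite inE mem_head.
have sP : P \subset ~: covered C.
  apply/subsetP=> z; rewrite inE in_setC => zP; apply: dQ.
  by rewrite -cat_cons mem_cat zP.
have ex : e != x by apply: contraTneq eT => ->; rewrite in_setD xP.
have [p [pc apx aep]] : exists p, [/\ p \in covered C, a p x & a e (succ C p)].
  apply: NNPP => no; have : inin a x (covered C) + outin a e (covered C) <= #|covered C|.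
    apply: (slot_count_covered pC) => p pc apx; apply/negP=> aep; apply: no; by exists p.
  have := W ex nex; rewrite (outdegC a e (covered C)) (indegC a x (covered C)).
  rewrite (outinD _ _ sP) (ininD _ _ sP).
  have := outin_self airr eT; have := inin_self airr xP; have := card_rest C.
  by rewrite -(cardsID P (~: covered C)) (setIidPr sP); move: le1; degree_lia.
have [j pj] := coveredP _ _ pc.
have aeq : a (last x (s ++ v :: R)) (succ C p) by rewrite last_cat.
have [pk _ cE] := ins_spec pC pj uQ pQ dQ apx aeq.
by exists (ins C j p (x :: s ++ v :: R)).
Qed.

Section PathRest.
Variables (C : I -> seq V) (x : V) (s : seq V).
Hypotheses (pC : packing a C) (us : uniq (x :: s)) (ps : path a x s).
Hypotheses (HE : ~: covered C = [set z in x :: s]) (s1 : size s <= 1).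
Local Notation y := (last x s).

Let dP : {in x :: s, forall z, z \notin covered C}.
Proof. by move=> z zP; rewrite -in_setC HE inE. Qed.

Let covT : covered C :|: [set z in x :: s] = setT.
Proof. by rewrite -HE setUCr. Qed.

Let cardV : #|covered C| + size (x :: s) = #|V|.
Proof. by rewrite -(cardsC (covered C)) HE (card_set_seq us). Qed.

Lemma close_slot p : p \in covered C -> a p x -> a y (succ C p) -> has_factor a I.
Proof.
move=> pc apx ayp; have [j pj] := coveredP _ _ pc.
have [pk _ cE] := ins_spec pC pj us ps dP apx ayp.
by exists (ins C j p (x :: s)); rewrite cE covT.
Qed.

Let O := [set p in covered C | a p x].
Let J := [set p in covered C | a y p].
Hypothesis noslot : forall p, p \in O -> succ C p \notin J.

Let degree_x : indeg a x <= #|O| + size s.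
Proof.
have xH : x \in ~: covered C by rewrite HE inE mem_head.
rewrite (indegC a x (covered C)) leq_add2l.
by have := inin_self airr xH; rewrite HE (card_set_seq us).
Qed.

Let degree_y : outdeg a y <= #|J| + size s.
Proof.
have yH : y \in ~: covered C by rewrite HE inE mem_last.
rewrite (outdegC a y (covered C)) leq_add2l.
by have := outin_self airr yH; rewrite HE (card_set_seq us).
Qed.

Lemma free_degree w : w \in covered C -> w \notin O -> w \notin J ->
  2 * #|V| <= outdeg a w + indeg a w + (#|O| + #|J| + 2 * size s).
Proof.
move=> wc; rewrite !in_sep wc /= => nO nJ.
have wx : w != x by apply: contraTneq wc => ->; apply: dP; rewrite mem_head.
have yw : y != w by apply: contraTneq wc => <-; apply: dP; rewrite mem_last.
have := W wx nO; have := W yw nJ; move: degree_x degree_y; card_lia.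
Qed.

(** The path is the whole uncovered part. A gap vertex has degree at least
    [#|covered C| + size G + 1], which is exactly what [gap_replace] needs for a path of two
    vertices; hence the bound on [s]. *)
Lemma close_gap j n o G R : rot n (C j) = o :: G ++ R -> a o x -> a y (head o R) ->
  1 < size s + size R + 1 -> {in G, forall w, w \notin O /\ w \notin J} -> has_factor a I.
Proof.
move=> E aox ayR sz hG.
have [|C' [pC' cC' _ _]] := gap_replace airr pC E us ps dP aox ayR sz; last first.
  by exists C'; rewrite cC' covT.
move=> w wG; rewrite covT -outinT -ininT.
have wc : w \in covered C.
  by rewrite (mem_covered (i := j)) // (mem_rot_eq E) inE mem_cat wG orbT.
have [wO wJ] := hG _ wG; have := free_degree wc wO wJ.
have := @gap_count _ a _ C j n o G R O J pC E _ _ noslot hG.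
have sO : O \subset covered C by apply/subsetP=> z; rewrite inE => /andP[].
have sJ : J \subset covered C by apply/subsetP=> z; rewrite inE => /andP[].
move=> /(_ sO sJ); have : 0 < size G by case: (G) wG.
move: cardV s1; rewrite /=; card_lia.
Qed.

End PathRest.

(** Distinct [u] and [v] lead to a tight pair. If [u = v] and no other vertex of the cycle lies in
    [O] or [J], the gap is the whole cycle except [v], and the triangle [v], [x], [last x s]
    replaces it; that is why the path must then have two vertices. *)
Lemma close_short C j x s u v : packing a C -> uniq (x :: s) -> path a x s ->
  ~: covered C = [set z in x :: s] -> size s <= 1 -> u \in C j -> v \in C j ->
  a u x -> a (last x s) v -> u != v \/ size s = 1 -> has_factor a I.
Proof.
move=> pC us ps HE s1 uj vj aux ayv uv.
case: (classic (exists2 p, p \in covered C & a p x /\ a (last x s) (succ C p))).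
  by case=> p pc [apx ayp]; exact: (close_slot pC us ps HE pc apx ayp).
move=> noslot.
set O := [set p in covered C | a p x]; set J := [set p in covered C | a (last x s) p].
have no p : p \in O -> succ C p \notin J.
  rewrite !in_sep => /andP[pc apx]; rewrite negb_and; apply/orP; right.
  by apply/negP=> ayp; apply: noslot; exists p.
have pair p q : p \in C j -> q \in C j -> p != q -> p \in O -> q \in J -> has_factor a I.
  move=> pj qj pq pO qJ.
  have [n [o [G [w [R [E oO wJ hG]]]]]] := split_cycle pC pj qj pq pO qJ.
  apply: (close_gap pC us ps HE s1 no E) => //=; last by rewrite addn1 addnS.
    by move: oO; rewrite in_sep => /andP[].
  by move: wJ; rewrite in_sep => /andP[].
have uO : u \in O by rewrite in_sep (mem_covered uj).
have vJ : v \in J by rewrite in_sep (mem_covered vj).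
have [E|] := eqVneq u v; last by move=> ne; apply: (pair u v).
subst u; move: uv; rewrite eqxx => -[//|s11].
case: (classic (exists2 w, w \in C j & w != v /\ (w \in O \/ w \in J))).
  case=> w wj [wv [wO|wJ]]; first exact: (pair w v).
  by apply: (pair v w); rewrite // eq_sym.
move=> alone; have [r Er _] := rot_to_head (packing_uniq j pC) vj.
apply: (@close_gap C x s pC us ps HE s1 no j (index v (C j)) v r [::]).
- by rewrite cats0.
- by [].
- by [].
- by rewrite s11.
move=> w wr; have wj : w \in C j by rewrite (mem_rot_eq Er) inE wr orbT.
have wv : w != v.
  have : uniq (v :: r) by rewrite -Er rot_uniq (packing_uniq _ pC).
  by move=> /andP[vr _]; apply: contraNneq vr => <-.
by split; apply/negP=> h; apply: alone; exists w => //; split=> //; [left|right].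
Qed.

(** Shrink cycle [j] to [Z], which frees [F]. From the first vertex [v0] of [F] that the path
    dominates, the rest of [F] prolongs the path; the longer path ends in [e], which has no arc to
    [x], so [splice] inserts it. The vertices of [F] before [v0] are nonadjacent in the relevant
    directions to both ends of the old path and are absorbed. *)
Lemma close_skip C j n x s Z F v : packing a C -> uniq (x :: s) -> path a x s ->
  ~: covered C = [set z in x :: s] -> size s <= 1 ->
  rot n (C j) = Z ++ F -> cycle a Z -> 3 <= size Z -> v \in F -> a (last x s) v ->
  {in C j, forall o, ~~ a o x} -> has_factor a I.
Proof.
move=> pC us ps HE s1 E cZ sZ vF ayv noO.
case: (classic (exists2 p, p \in covered C & a p x /\ a (last x s) (succ C p))).
  by case=> p pc [apx ayp]; exact: (close_slot pC us ps HE pc apx ayp).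
move=> noslot; set y := last x s in ayv noslot *.
have [|F1 [v0 [F2 [EF ayv0 hF1]]]] := @split_first _ (a y) F.
  by apply/hasP; exists v.
have U : uniq (Z ++ F) by rewrite -E rot_uniq (packing_uniq _ pC).
have /and3P[UZ /hasPn ZF UF] : [&& uniq Z, ~~ has (mem Z) F & uniq F] by rewrite -cat_uniq.
have mj z : z \in C j = (z \in Z) || (z \in F) by rewrite (mem_rot_eq E) mem_cat.
pose e := last v0 F2.
have eF : e \in F by rewrite EF mem_cat mem_last orbT.
have ej : e \in C j by rewrite mj eF orbT.
have dP : {in x :: s, forall z, z \notin covered C} by move=> z zP; rewrite -in_setC HE inE.
have nex := noO _ ej.
have gZ : long_cycle a Z by apply/and3P.
pose C1 := upd C j Z.
have pC1 : packing a C1.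
  apply: upd_packing => // i' z ij' zZ; apply/negP=> zi; case: pC => _ dC.
  by move/eqP: ij'; apply; apply: dC zi _; rewrite mj zZ.
have mC1 z : (z \in covered C1) = (z \in covered C) && (z \notin F).
  rewrite (covered_upd _ _ pC) in_setU in_setD [z \in [set _ in C j]]inE [z \in [set _ in Z]]inE.
  rewrite mj; case zF: (z \in F) => /=; first by have := ZF _ zF; rewrite orbT andbF inE => /negbTE->.
  case zZ: (z \in Z); rewrite /= ?orbF ?andbT // (mem_covered (i := j)) //.
  by rewrite mj zZ.
have Q : [/\ uniq (x :: s ++ v0 :: F2), path a x (s ++ v0 :: F2) &
             {in x :: s ++ v0 :: F2, forall z, z \notin covered C1}].
  have sF z : z \in v0 :: F2 -> z \in F by rewrite EF mem_cat => ->; rewrite orbT.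
  have Pf z : z \in x :: s -> z \notin F.
    move/dP; apply: contra => zF; apply: (mem_covered (i := j)); by rewrite mj zF orbT.
  split.
  - rewrite -cat_cons cat_uniq us andTb; apply/andP; split.
      by apply/hasPn=> z /sF zF; apply: contraTN zF => /Pf.
    by move: UF; rewrite EF cat_uniq => /and3P[].
  - rewrite cat_path ps /= ayv0 /=.
    have : cycle a (Z ++ F) by rewrite -E rot_cycle (packing_cycle _ pC).
    rewrite EF; case: (Z) sZ => //= z Z' _.
    by rewrite -cats1 -!catA cat_path /= cat_path /= cat_path => /and5P[_ _ _ -> _].
  - move=> z; rewrite -cat_cons mem_cat mC1 negb_and => /orP[/dP->//|/sF ->].
    by rewrite orbT.
case: Q => uQ pQ dQ.
have HE1 : ~: covered C1 :\: [set z in x :: s] = [set z in F].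
  apply/setP=> z; rewrite in_setD in_setC mC1 [z \in [set _ in F]]inE negb_and negbK -HE.
  rewrite in_setC negbK; case zF: (z \in F); last by rewrite orbF andbN.
  by rewrite orbT andbT (mem_covered (i := j)) // mj zF orbT.
(* [x] receives nothing from [F] and [e] has no arc to [x], so only an arc from [e] to a second
   vertex of the path can count. *)
have [|C2 [pC2 cC2]] := splice pC1 uQ pQ dQ nex.
  rewrite HE1 [inin _ _ _]inin0 ?addn0; last first.
    by move=> z; rewrite inE => zF; apply: noO; rewrite mj zF orbT.
  have sx : [set x] \subset [set z in x :: s] by rewrite sub1set inE mem_head.
  have : outin a (last v0 F2) [set z in x :: s] + #|[set x]| <= #|[set z in x :: s]|.
    by apply: outin_avoid => // z /set1P->.
  by rewrite cards1 (card_set_seq us); move: s1; degree_lia.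
pose Gs := [set z in F1].
have UF1 : uniq F1 by move: UF; rewrite EF cat_uniq => /and3P[].
have GsE : #|Gs| = size F1 by exact: card_set_seq.
have F1F z : z \in F1 -> z \in F by rewrite EF mem_cat => ->.
have mC2 z : (z \in covered C2) = (z \notin F1).
  rewrite cC2 in_setU mC1 [z \in [set _ in _]]inE -cat_cons mem_cat.
  case zF1: (z \in F1).
    rewrite (F1F _ zF1) andbF /=; apply/norP; split.
      by apply: contraTN zF1 => /dP; apply: contra => /F1F zF; apply: (mem_covered (i := j)); rewrite mj zF orbT.
    by move: UF; rewrite EF cat_uniq => /and3P[_ /hasPn h _]; apply: contraTN zF1 => /h.
  case zP: (z \in x :: s); first by rewrite orbT.
  have zc : z \in covered C by apply: contraFT zP; rewrite -in_setC HE inE.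
  by rewrite zc EF mem_cat zF1; case: (z \in _ :: F2).
have dis : [disjoint covered C2 & Gs].
  by rewrite disjoints_subset; apply/subsetP=> z; rewrite mC2 in_setC inE.
have Un : covered C2 :|: Gs = setT.
  by apply/setP=> z; rewrite in_setU mC2 [z \in Gs]inE inE orNb.
have cd : #|covered C2| + size F1 = #|V|.
  rewrite -GsE -cardsUI Un cardsT (_ : _ :&: Gs = set0) ?cards0 ?addn0 //.
  by apply/eqP; rewrite setI_eq0.
have [|C' [pC' cC' _]] := absorb airr pC2 dis; last by exists C'; rewrite cC' Un.
move=> w; rewrite inE => wF1; rewrite Un -outinT -ininT GsE.
set O := [set p in covered C | a p x]; set J := [set p in covered C | a y p].
have wj : w \in C j by rewrite mj F1F ?orbT.
have wc := mem_covered wj.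
have wO : w \notin O by rewrite in_sep negb_and (noO _ wj) orbT.
have wJ : w \notin J by rewrite in_sep negb_and (hF1 _ wF1) orbT.
have : 2 * #|V| <= outdeg a w + indeg a w + (#|O| + #|J| + 2 * size s).
  have free := free_degree us HE wc wO wJ; exact: free.
(* [O] avoids cycle [j], so its successors avoid [F1]; [J] avoids [F1] by the choice of [v0], and
   avoids the successors of [O] because there is no slot. *)
have : #|O| + #|J| + size F1 <= #|covered C|.
  rewrite -(card_imset _ (succ_inj pC)) -GsE -cardsUI.
  rewrite (_ : _ :&: J = set0) ?cards0 ?addn0; last first.
    apply/setP=> z; rewrite in_set0 in_setI; apply/negP=> /andP[/imsetP[q]].
    rewrite !in_sep => /andP[qc aqx] -> /andP[_ ayq]; apply: noslot; by exists q.
  rewrite -cardsUI (_ : _ :&: Gs = set0) ?cards0 ?addn0; last first.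
    apply/setP=> z; rewrite in_set0 in_setI in_setU [z \in Gs]inE.
    apply/negP=> /andP[/orP[/imsetP[q]|]].
      rewrite inE => /andP[_ aqx] ez zF1; have : q \in C j.
        by rewrite -(succ_mem _ _ pC) -ez mj F1F ?orbT.
      by move/noO; rewrite aqx.
    by rewrite inE => /andP[_ ayz] /hF1; rewrite ayz.
  apply/subset_leq_card/subsetP=> z; rewrite !in_setU => /orP[/orP[/imsetP[q]|]|].
  - by rewrite inE => /andP[qc _] ->; rewrite (succ_covered _ pC).
  - by rewrite inE => /andP[].
  by rewrite inE => zF1; apply: (mem_covered (i := j)); rewrite mj F1F ?orbT.
have : #|covered C| + size (x :: s) = #|V|.
  by rewrite -(cardsC (covered C)) HE (card_set_seq us).
by move: cd s1; rewrite /=; card_lia.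
Qed.

End Close.

(** * Removing a cycle *)

Section Converse.
Variables (V : finType) (a : rel V).
Implicit Types (x y u v w p o t : V) (c s P G R : seq V).

Definition converse : rel V := fun x y => a y x.

Lemma woodall_converse : woodall a -> woodall converse.
Proof. by move=> W u v uv nuv; rewrite addnC; apply: W; rewrite // eq_sym. Qed.

Lemma long_cycle_converse c : long_cycle a c -> long_cycle converse (rev c).
Proof.
case/and3P=> sc uc cc; apply/and3P; split; rewrite ?size_rev ?rev_uniq //.
by rewrite rev_cycle.
Qed.

Section Index.
Variable I : finType.
Implicit Types (C : I -> seq V).

Lemma packing_converse C : packing a C -> packing converse (fun i => rev (C i)).
Proof.
case=> gC dC; split=> [i|i j x]; first exact: long_cycle_converse.
by rewrite !mem_rev; apply: dC.
Qed.

Lemma covered_rev C : covered (fun i => rev (C i)) = covered C.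
Proof. by apply/setP=> x; apply/coveredP/coveredP=> -[i]; rewrite ?mem_rev; exists i; rewrite ?mem_rev. Qed.

Lemma succ_rev C p : packing a C -> succ C (succ (fun i => rev (C i)) p) = p.
Proof.
move=> pC; have pR := packing_converse pC.
case: (boolP (p \in covered C)) => [/coveredP[i pi]|np]; last by rewrite [succ _ p]succ_off ?succ_off ?covered_rev.
rewrite (succE pR (i := i)) ?mem_rev // next_rev ?(packing_uniq _ pC) //.
by rewrite (succE pC (i := i)) ?mem_prev // next_prev // (packing_uniq _ pC).
Qed.

End Index.

End Converse.

Lemma has_factor_converse (V I : finType) (a : rel V) :
  has_factor (converse a) I -> has_factor a I.
Proof.
case=> C [pC cC]; exists (fun i => rev (C i)); rewrite covered_rev; split=> //.
exact: (packing_converse pC).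
Qed.

Lemma path_converse (V : finType) (a : rel V) x s : path a x s ->
  exists s', [/\ path (converse a) (last x s) s', last (last x s) s' = x,
                 rev (x :: s) = last x s :: s' & size s' = size s].
Proof.
move=> ps; exists (rev (belast x s)); rewrite -rev_path in ps.
have e : rev (x :: s) = last x s :: rev (belast x s) by rewrite lastI rev_rcons.
split=> //; last by rewrite size_rev size_belast.
by case: (s) => //= y l; rewrite rev_cons last_rcons.
Qed.

Section Remove.
Variables (V : finType) (a : rel V).
Implicit Types (x y u v w p o t : V) (c s P G R : seq V).
Variable k : nat.
Implicit Type C : 'I_k.+1 -> seq V.

Definition remove C (i : 'I_k.+1) : 'I_k -> seq V := fun j => C (lift i j).

Lemma remove_packing C i : packing a C -> packing a (remove C i).
Proof.
case=> gC dC; split=> [j|j j' x xj xj']; first exact: gC.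
exact: lift_inj (dC _ _ _ xj xj').
Qed.

Lemma covered_remove C i : packing a C -> covered (remove C i) = covered C :\: [set z in C i].
Proof.
case=> _ dC; apply/setP=> z; rewrite in_setD [z \in [set _ in _]]inE.
apply/coveredP/andP => [[j zj]|[zi /coveredP[j zj]]].
  split; last by apply/coveredP; exists (lift i j).
  by apply/negP=> zi; have := neq_lift i j; rewrite -(dC _ _ _ zi zj) eqxx.
case: (unliftP i j) zj => [j' ->|->]; first by exists j'.
by rewrite (negbTE zi).
Qed.

Lemma succ_remove C i p : packing a C -> p \in covered (remove C i) -> succ (remove C i) p = succ C p.
Proof.
move=> pC /coveredP[j pj].
by rewrite (succE (remove_packing i pC) pj) (succE pC (i := lift i j)).
Qed.

Definition add_cycle c (Y : 'I_k -> seq V) : 'I_k.+1 -> seq V :=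
  fun i => if unlift ord0 i is Some j then Y j else c.

Lemma add_packing c Y : packing a Y -> long_cycle a c -> (forall z, z \in c -> z \notin covered Y) ->
  packing a (add_cycle c Y) /\ covered (add_cycle c Y) = covered Y :|: [set z in c].
Proof.
move=> [gY dY] gc dc; split; first split=> [i|i j x].
- by rewrite /add_cycle; case: unliftP.
- rewrite /add_cycle; case: unliftP => [i' ->|->]; case: unliftP => [j' ->|->] //.
  + by move=> xi xj; rewrite (dY _ _ _ xi xj).
  + by move=> xi /dc; rewrite (mem_covered xi).
  + by move=> /dc h xj; rewrite (mem_covered xj) in h.
- apply/setP=> x; rewrite in_setU [x \in [set _ in c]]inE.
  apply/coveredP/orP=> [[i]|[/coveredP[j xj]|xc]].
  + by rewrite /add_cycle; case: unliftP => [i' _ xi|_ xc]; [left; apply: mem_covered xi | right].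
  + by exists (lift ord0 j); rewrite /add_cycle liftK.
  + by exists ord0; rewrite /add_cycle unlift_none.
Qed.

Lemma rot_from_succ (I : finType) (D : I -> seq V) j p : packing a D -> p \in D j ->
  exists n r, [/\ rot n (D j) = succ D p :: r, last (succ D p) r = p,
                  path a (succ D p) r & uniq (succ D p :: r)].
Proof.
move=> pD pj; have vj : succ D p \in D j by rewrite (succ_mem _ _ pD).
have [r Er _] := rot_to_head (packing_uniq j pD) vj; set v := succ D p in vj Er *.
have U : uniq (v :: r) by rewrite -Er rot_uniq (packing_uniq _ pD).
exists (index v (D j)), r; split=> //.
  apply: (succ_inj pD); rewrite -/v.
  have lj : last v r \in D j by rewrite (mem_rot_eq Er) mem_last.
  rewrite (succ_rot pD lj Er) lastI next_cat_last -?lastI //.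
  by case: (r).
have : cycle a (v :: r) by rewrite -Er rot_cycle (packing_cycle _ pD).
by rewrite /= rcons_path => /andP[].
Qed.

Lemma succ_succ_neq (I : finType) (D : I -> seq V) j p : packing a D -> p \in D j ->
  succ D (succ D p) != p.
Proof.
move=> pD pj; have [n [r [Er lr pr U]]] := rot_from_succ pD pj.
have sj : succ D p \in D j by rewrite (succ_mem _ _ pD).
have : 3 <= size (succ D p :: r) by rewrite -Er size_rot (packing_size _ pD).
move: lr Er U; case: r {pr} => [|b [|b' r]] // lr Er U _.
rewrite (succ_rot pD sj Er) next_head //=; apply/negP=> /eqP eb; rewrite eb /= in lr U.
by move: U; rewrite -lr /= mem_last !andbF.
Qed.

(** Opened before [succ C p], cycle [j] is a path from [succ C p] to [p], inserted whole between [q]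
    and [succ C q]. *)
Lemma dissolve_path C i j p q : packing a C -> covered C = setT -> p \in C j -> q \in C i ->
  i != j -> a q (succ C p) -> a p (succ C q) -> has_factor a 'I_k.
Proof.
move=> pC cC pj qi ij aqv aps.
have [n [r [Er lr pr U]]] := rot_from_succ pC pj.
have pD := remove_packing j pC.
case: (unliftP j i) qi ij => [i' Ei|->]; last by rewrite eqxx.
rewrite Ei => qi _.
have dP : {in succ C p :: r, forall z, z \notin covered (remove C j)}.
  by move=> z zP; rewrite (covered_remove j pC) in_setD [z \in _]inE (mem_rot_eq Er) zP.
have aps' : a (last (succ C p) r) (succ (remove C j) q).
  by rewrite lr succ_remove //; apply: (mem_covered (i := i')).
have [pk _ cE] := ins_spec pD (j := i') qi U pr dP aqv aps'.
exists (ins (remove C j) i' q (succ C p :: r)); split=> //; rewrite cE (covered_remove j pC) cC.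
apply/setP=> z; rewrite in_setU in_setD [z \in [set _ in C j]]inE (mem_rot_eq Er).
by rewrite [z \in [set _ in _ :: _]]inE !in_setT andbT orNb.
Qed.

End Remove.

(** * Maximal packings that do not span *)

Section AbsorbRest.
Variables (V : finType) (a : rel V).
Hypotheses (airr : irreflexive a) (W : woodall a).

(** [e] precedes a vertex [v] that receives an arc from the uncovered part, so by [into_from] it
    sends none there. The inserted path is a Hamiltonian path of the uncovered part ending in an
    in-neighbour of [v], followed by cycle [j] from [v] to [e]. *)
Lemma absorb_rest k (C : 'I_k.+1 -> seq V) : packing a C -> maximal a C ->
  (exists x, x \notin covered C) -> has_factor a 'I_k.
Proof.
move=> pC mC [x0 x0C]; have sC := maximal_stuck pC mC.
have H0 : 0 < #|~: covered C| by apply/card_gt0P; exists x0; rewrite in_setC.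
have N0 : 0 < #|covered C|.
  apply/card_gt0P; have := packing_size ord0 pC; case E: (C ord0) => [|z c] // _.
  by exists z; apply: (mem_covered (i := ord0)); rewrite E mem_head.
have [v vI] := from_rest_neq0 airr W N0 H0.
have [vc [t tH atv]] := from_restP _ _ _ vI.
have [j vj] := coveredP _ _ vc.
have [e ej ev] := succ_surj pC vj.
have eO : e \notin into_rest a C.
  by apply/negP=> /(into_from airr W pC sC); rewrite ev vI.
have neH z : z \in ~: covered C -> ~~ a e z.
  move=> zH; apply: contra eO => aez; apply/into_restP; split; last by exists z.
  exact: mem_covered ej.
have [x [s [ps ls us mP]]] := rest_ham_path airr W pC sC tH.
have [n [r [Er lr pr U]]] := rot_from_succ pC ej; rewrite ev in Er lr pr U.
have HP : [set z in x :: s] = ~: covered C by apply/setP=> z; rewrite inE mP.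
have pD := remove_packing j pC.
have mj z : z \in C j = (z \in v :: r) := mem_rot_eq Er z.
have [C' [pC' cC']] : exists C' : 'I_k -> seq V, packing a C' /\
    covered C' = covered (remove C j) :|: [set z in x :: s ++ v :: r].
  apply: (splice airr W pD).
  - rewrite -cat_cons cat_uniq us U andbT; apply/hasPn=> z.
    by rewrite -mj => zj; change (z \notin x :: s); rewrite mP in_setC (mem_covered zj).
  - by rewrite cat_path ps ls /= atv.
  - move=> z; rewrite -cat_cons mem_cat (covered_remove j pC) in_setD [z \in [set _ in _]]inE mj.
    by case/orP=> [|->//]; rewrite mP in_setC negb_and orbC => ->.
  - by rewrite lr; apply: neH; rewrite -mP mem_head.
  rewrite lr [outin _ _ _]outin0 ?add0n; last by move=> z; rewrite HP; apply: neH.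
  (* An in-neighbour of [x] on cycle [j] other than [v] would form a bridge with [v], against
     maximality. *)
  rewrite -[leqRHS](cards1 v); apply/subset_leq_card/subsetP=> z.
  rewrite in_sep in_set1 (covered_remove j pC) HP in_setD in_setC negbK => /andP[/andP[zc]].
  rewrite in_setC in_setD zc andbT negbK inE => zj azx.
  apply: contraT => zv; have zO : z \in into_rest a C.
    by apply/into_restP; split=> //; exists x; rewrite // -mP mem_head.
  have [C' [y [l [pC' dP cE _ _]]]] := bridge_augment airr W pC sC zj vj zv zO vI.
  by have := mC _ pC'; rewrite cE leqNgt card_covered_ins.
exists C'; split=> //; apply/setP=> z; rewrite cC' (covered_remove j pC) !in_setU in_setD in_setT.
rewrite [z \in [set _ in C j]]inE mj [z \in [set _ in _ :: _]]inE -cat_cons mem_cat mP in_setC.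
by case: (z \in v :: r); case: (z \in covered C).
Qed.

End AbsorbRest.

(** * Segments that can be cut out of a cycle again *)

Section Rotations.
Variable T : eqType.
Implicit Types (c r s A B P : seq T) (p : T).

Lemma rot_rot_ex m n s : exists l, rot m (rot n s) = rot l s.
Proof.
case: (leqP n (size s)) => [ns|/ltnW ns]; last by rewrite (rot_oversize ns); exists m.
case: (leqP m (size s)) => [ms|/ltnW ms]; last by rewrite rot_oversize ?size_rot //; exists n.
by rewrite rot_add_mod //; eexists.
Qed.

Lemma rot_rev_ex n s : exists l, rot l (rev s) = rev (rot n s).
Proof. by rewrite rev_rot; exists (size (rev s) - n). Qed.

Lemma rot_same_head m p r r' : uniq (p :: r) -> rot m (p :: r) = p :: r' -> r' = r.
Proof.
move=> U; case: (leqP (size (p :: r)) m) => [h|h]; first by rewrite rot_oversize // => -[].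
rewrite /rot (drop_nth p h) cat_cons => -[e E].
have m0 : m = 0 by apply/eqP; rewrite -(nth_uniq p h _ U) //= e.
by move: E; rewrite m0 take0 cats0 /= drop0.
Qed.

Lemma rot_at_mid n c A p B : uniq c -> rot n c = A ++ p :: B ->
  rot (index p c) c = p :: B ++ A.
Proof.
move=> U E; have pc : p \in c by rewrite -(mem_rot n) E mem_cat mem_head orbT.
have [r Er _] := rot_to_head U pc; rewrite Er; congr cons.
have [l El] := rot_rot_ex (size A) n c; rewrite E rot_size_cat in El.
have Ec : c = rot (size (p :: r) - index p c) (p :: r).
  by rewrite -[LHS](rotK (index p c)) Er.
have [m Em] := rot_rot_ex l (size (p :: r) - index p c) (p :: r).
rewrite -Ec -El in Em; symmetry; apply: (@rot_same_head m p) => //.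
by rewrite -Er rot_uniq.
Qed.

End Rotations.

Section Skip.
Variables (V : finType) (a : rel V).
Implicit Types (x y u v w p o t : V) (c s P G R : seq V).

(** The trace left by an insertion: [F] contains what was inserted, and [Z] is a cycle that remains
    when [F] is cut out. *)
Definition skippable (I : finType) (C : I -> seq V) j v :=
  exists n Z F, [/\ rot n (C j) = Z ++ F, cycle a Z, 3 <= size Z & v \in F].

Variable I : finType.
Implicit Types (C : I -> seq V).

Lemma ins_rot C j n p P A B : uniq (C j) -> rot n (C j) = A ++ p :: B ->
  exists m, rot m (ins C j p P j) = A ++ p :: P ++ B.
Proof.
move=> U E; rewrite /ins upd_eq (rot_at_mid U E) /= catA -cat_cons.
by exists (size (p :: P ++ B)); rewrite rot_size_cat.
Qed.

Section Insert.
Variables (C : I -> seq V) (j : I) (p x : V) (s : seq V).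
Hypotheses (pC : packing a C) (pj : p \in C j) (ps : path a x s) (apx : a p x)
  (aly : a (last x s) (succ C p)).

Lemma ins_skippable_new v : v \in x :: s -> skippable (ins C j p (x :: s)) j v.
Proof.
move=> vP; have [r Er _] := rot_to_head (packing_uniq j pC) pj.
exists (size (p :: x :: s)), (rcons r p), (x :: s); split=> //.
- by rewrite /ins upd_eq Er -cat_cons rot_size_cat cat_rcons.
- by rewrite -rot1_cons rot_cycle -Er rot_cycle (packing_cycle _ pC).
- by have := packing_size j pC; rewrite -(size_rot (index p (C j))) Er size_rcons.
Qed.

(** An insertion behind a vertex of [F], or behind the last vertex of [Z], lengthens [F]; behind any
    other vertex of [Z] it lengthens the cycle [Z]. *)
Lemma ins_skippable i v : skippable C i v -> skippable (ins C j p (x :: s)) i v.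
Proof.
case=> n [Z [F [E cZ sZ vF]]]; case: (eqVneq i j) => [Ei|ij]; last first.
  by exists n, Z, F; rewrite /ins upd_neq.
rewrite Ei in E *; have U := packing_uniq j pC.
have : p \in Z ++ F by rewrite -(mem_rot_eq E).
rewrite mem_cat => /orP[] pin; case/splitPr: pin E cZ sZ vF => A B E cZ sZ vF; last first.
  rewrite catA in E; have [m Em] := ins_rot (x :: s) U E.
  exists m, Z, (A ++ p :: (x :: s) ++ B); split=> //; first by rewrite Em -catA.
  by move: vF; rewrite !mem_cat !inE mem_cat => /or3P[->|->|->]; rewrite ?orbT.
case: B E cZ sZ => [|b B] E cZ sZ.
  rewrite -catA in E; have [m Em] := ins_rot (x :: s) U E.
  exists m, (A ++ [:: p]), ((x :: s) ++ F); split=> //; first by rewrite Em -catA.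
  by rewrite mem_cat vF orbT.
have pb : succ C p = b.
  rewrite (succ_rot pC pj E) -catA /= next_cat_cons //.
  by have := U; rewrite -(rot_uniq n) E -catA.
rewrite -catA in E; have [m Em] := ins_rot (x :: s) U E.
exists m, (A ++ p :: (x :: s) ++ b :: B), F; split=> //.
- by rewrite Em -!catA /= -!catA.
- rewrite -(rot_cycle (size A)) rot_size_cat cat_cons -catA.
  apply: cycle_insert; first by rewrite /= apx rcons_path ps /= -pb.
  by have := cZ; rewrite -(rot_cycle (size A)) rot_size_cat.
- by move: sZ; rewrite !size_cat /= !size_cat /=; lia.
Qed.

End Insert.

End Skip.

Lemma skippable_converse (V I : finType) (a : rel V) (C : I -> seq V) j v :
  skippable a C j v -> skippable (converse a) (fun i => rev (C i)) j v.
Proof.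
case=> n [Z [F [E cZ sZ vF]]].
have [l El] := rot_rev_ex n (C j); rewrite E rev_cat in El.
have [m Em] := rot_rot_ex (size (rev F)) l (rev (C j)).
exists m, (rev Z), (rev F); rewrite size_rev mem_rev rev_cycle; split=> //.
by rewrite -Em El rot_size_cat.
Qed.

(** * Closing up when one or two vertices remain *)

Section Finish.
Variables (V : finType) (a : rel V).
Hypotheses (airr : irreflexive a) (W : woodall a).
Implicit Types (x y u v w p o t : V) (c s P G R : seq V).
Variable k : nat.
Implicit Types (C : 'I_k.+1 -> seq V) (Y : 'I_k -> seq V).

(** If nothing on cycle [j] dominates [x], [close_skip] applies; otherwise [close_short] does,
    unless the path is the single vertex [x] and [v] is its only neighbour on that cycle. In that
    case [x] has small degree, so the vertices of cycle [lift i j] of the original spanning packing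
    have large degree, and that cycle is dissolved instead of [C i]. *)
Lemma finish_skip C (i : 'I_k.+1) Y j x s v : packing a C -> covered C = setT -> packing a Y ->
  uniq (x :: s) -> path a x s -> ~: covered Y = [set z in x :: s] -> size s <= 1 ->
  v \in Y j -> a (last x s) v -> skippable a Y j v ->
  {subset C (lift i j) <= Y j} -> v \notin C (lift i j) -> has_factor a 'I_k.
Proof.
move=> pC cC pY us ps HE s1 vj ayv [n [Z [F [E cZ sZ vF]]]] sub vC.
case: (classic (exists2 o, o \in Y j & a o x)) => [[o oj aox]|no]; last first.
  apply: (close_skip airr W pY us ps HE s1 E cZ sZ vF ayv) => o oj.
  by apply/negP=> aox; apply: no; exists o.
case: (classic (o != v \/ size s = 1)) => [ov|nov].
  exact: (close_short airr W pY us ps HE s1 oj vj aox ayv ov).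
have s0 : s = [::] by move: s1 nov; case: (s) => [|? []] //= _ []; right.
subst s => {s1 ps nov us}; rewrite /= in ayv HE.
have us1 : uniq [:: x] by [].
have ps1 : path a x [::] by [].
have HE1 : ~: covered Y = [set z in [:: x]] by [].
case: (classic (exists o w, [/\ o \in Y j, w \in Y j, a o x, a x w & o != w])).
  case=> o' [w [oj' wj aox' axw ow]].
  exact: (close_short airr W pY us1 ps1 HE1 isT oj' wj aox' axw (or_introl ow)).
move=> single.
case: (classic (exists2 p, p \in covered Y & a p x /\ a x (succ Y p))).
  by case=> p pc [apx ayp]; exact: (close_slot pY us1 ps1 HE1 pc apx ayp).
move=> noslot.
have onlyout w : w \in Y j -> a x w -> w = o.
  move=> wj axw; apply/eqP; apply: contraT => wo.
  by case: single; exists o, w; split; rewrite // eq_sym.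
have ov : v = o by apply: onlyout.
have onlyin w : w \in Y j -> a w x -> w = o.
  move=> wj awx; apply/eqP; apply: contraT => wo.
  by case: single; exists w, v; split; rewrite // ov.
have xC : x \in ~: covered Y by rewrite HE inE mem_head.
pose D := remove C (lift i j); have pD := remove_packing (lift i j) pC.
pose S := [set z in C (lift i j)].
have DE : covered D = ~: S by rewrite (covered_remove _ pC) cC setTD.
have dis : [disjoint covered D & S] by rewrite DE disjoint_sym disjC.
have Un : covered D :|: S = setT by rewrite DE setUC setUCr.
have [|C' [pC' cC' _]] := absorb airr pD dis; last by exists C'; rewrite cC' Un.
move=> w; rewrite inE => wS; rewrite Un -outinT -ininT.
have wj : w \in Y j by apply: sub.
have wo : w != o by apply: contraNneq vC => wo; rewrite ov -wo; exact: wS.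
have xw : x != w by apply: contraTneq xC => ->; rewrite in_setC negbK (mem_covered wj).
have nxw : ~~ a x w by apply: contra wo => /(onlyout _ wj)->.
have nwx : ~~ a w x by apply: contra wo => /(onlyin _ wj)->.
pose Yj := [set z in Y j]; pose B := covered Y :\: Yj.
have sYj : Yj \subset covered Y by apply/subsetP=> z; rewrite inE; apply: mem_covered.
have cV : #|covered Y| + 1 = #|V|.
  by rewrite -(cardsC (covered Y)) HE (card_set_seq us1).
have cB : #|B| + #|Yj| = #|covered Y|.
  by rewrite -(cardsID Yj (covered Y)) (setIidPr sYj) addnC.
have slots : inin a x B + outin a x B <= #|B|.
  apply: (slot_count pY) => p.
    by rewrite !in_setD (succ_covered _ pY) ![_ \in Yj]inE (succ_mem _ _ pY).
  by rewrite in_setD => /andP[_ pc] apx; apply/negP=> axp; apply: noslot; exists p.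
have oYj : outin a x Yj <= 1.
  rewrite -[leqRHS](cards1 o); apply/subset_leq_card/subsetP=> z.
  by rewrite in_sep in_set1 [z \in Yj]inE => /andP[zj /(onlyout _ zj)->].
have iYj : inin a x Yj <= 1.
  rewrite -[leqRHS](cards1 o); apply/subset_leq_card/subsetP=> z.
  by rewrite in_sep in_set1 [z \in Yj]inE => /andP[zj /(onlyin _ zj)->].
have SY : #|S| < #|Yj|.
  apply: proper_card; apply/properP; split.
    by apply/subsetP=> z; rewrite !inE; apply: sub.
  by exists v; rewrite inE.
have cS : #|covered D| + #|S| = #|V| by rewrite DE addnC cardsC.
have := woodall2 W xw nxw nwx.
rewrite (outdegC a x (covered Y)) (indegC a x (covered Y)) (outinD _ _ sYj) (ininD _ _ sYj) -/B.
have := outin_self airr xC; have := inin_self airr xC; rewrite HE (card_set_seq us1).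
by move: cV cB slots oYj iYj SY cS; rewrite -/D; degree_lia.
Qed.

End Finish.

Section FinishBoth.
Variables (V : finType) (a : rel V).
Hypotheses (airr : irreflexive a) (W : woodall a).
Implicit Types (x y u v w p o t : V) (c s P G R : seq V).
Variable k : nat.
Implicit Types (C : 'I_k.+1 -> seq V) (Y : 'I_k -> seq V).

Lemma finish_skip_head C (i : 'I_k.+1) Y j x s u : packing a C -> covered C = setT -> packing a Y ->
  uniq (x :: s) -> path a x s -> ~: covered Y = [set z in x :: s] -> size s <= 1 ->
  u \in Y j -> a u x -> skippable a Y j u ->
  {subset C (lift i j) <= Y j} -> u \notin C (lift i j) -> has_factor a 'I_k.
Proof.
move=> pC cC pY us ps HE s1 uj aux sk sub uC; apply: has_factor_converse.
have [s' [ps' ls' rs' ss']] := path_converse ps.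
apply: (@finish_skip _ (converse a) airr (woodall_converse W) k (fun i => rev (C i)) i
   (fun j => rev (Y j)) j (last x s) s' u).
- exact: packing_converse.
- by rewrite covered_rev.
- exact: packing_converse.
- by rewrite -rs' rev_uniq.
- by [].
- by rewrite covered_rev HE; apply/setP=> z; rewrite !inE -!in_cons -rs' mem_rev.
- by rewrite ss'.
- by rewrite mem_rev.
- by rewrite ls'.
- exact: skippable_converse.
- by move=> z; rewrite !mem_rev; apply: sub.
- by rewrite mem_rev.
Qed.

(* i is the cycle being dissolved and j0 the cycle of Y1 that received its other vertices *)
Lemma finish C (i : 'I_k.+1) (Y1 : 'I_k -> seq V) j0 : packing a C -> covered C = setT -> packing a Y1 ->
  {subset ~: covered Y1 <= C i} -> (exists2 z, z \in C i & z \in covered Y1) ->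
  (forall z, z \in C i -> z \in covered Y1 -> z \in Y1 j0) ->
  (forall j, j != j0 -> {subset C (lift i j) <= Y1 j}) ->
  (forall C' i', packing a C' -> covered C' = setT -> size (C' i') < size (C i) ->
     has_factor a 'I_k) ->
  has_factor a 'I_k.
Proof.
move=> pC cC pY1 sub [z0 z0i z0c] inj0 oth IH.
(* [Q] records that whatever was inserted after [Y1] can be cut out again. *)
pose Q Y := (forall j, {subset Y1 j <= Y j}) /\
  (forall j v, v \in Y j -> v \in Y1 j \/ skippable a Y j v).
have QI Y j p x s : packing a Y -> Q Y -> p \in Y j -> uniq (x :: s) -> path a x s ->
    {in x :: s, forall z, z \notin covered Y} -> a p x -> a (last x s) (succ Y p) ->
    Q (ins Y j p (x :: s)).
  move=> pY [Q1 Q2] pj us ps dP apx aly.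
  have [_ mE _] := ins_spec pY pj us ps dP apx aly; split=> [j' z zj'|j' v].
    by rewrite mE Q1.
  rewrite mE => /orP[/Q2[|sk]|/andP[/eqP-> vP]]; [by left| |].
    by right; apply: ins_skippable.
  by right; apply: ins_skippable_new.
have Q0 : Q Y1 by split=> [j z //|j v vj]; left.
have [Y [pY [QY1 QY2] sY]] := stuck_extend QI pY1 Q0.
have sR : {subset ~: covered Y <= C i}.
  move=> z zY; apply: sub; move: zY; rewrite !in_setC; apply: contra => /coveredP[j zj].
  by apply/coveredP; exists j; apply: QY1.
have Ccard : #|[set z in C i]| = size (C i) by apply: card_set_seq; apply: packing_uniq pC.
have ltR : #|~: covered Y| < size (C i).
  rewrite -Ccard; apply: proper_card; apply/properP; split.
    by apply/subsetP=> z /sR; rewrite inE.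
  exists z0; first by rewrite inE.
  rewrite in_setC negbK; have [j z0j] := coveredP _ _ z0c.
  by apply/coveredP; exists j; apply: QY1.
have [R0|[x0 x0R]] := set_0Vmem (~: covered Y).
  by exists Y; split=> //; rewrite -[LHS]setCK R0 setC0.
(* Three or more remaining vertices carry a Hamiltonian cycle, which is smaller than [C i] because
   [z0] has moved elsewhere; the induction hypothesis takes over. *)
case: (leqP 3 #|~: covered Y|) => [R3|R2].
  have [c gc mc] := rest_hamiltonian airr W pY sY R3.
  have [|pC' cC'] := add_packing pY gc; first by move=> z; rewrite mc in_setC.
  apply: (IH (add_cycle c Y) ord0 pC').
    by rewrite cC'; apply/setP=> z; rewrite in_setU [z \in [set _ in c]]inE mc in_setC orbN in_setT.
  rewrite /add_cycle unlift_none; have /and3P[_ uc _] := gc.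
  by rewrite -(card_set_seq uc) (eq_card (B := ~: covered Y)) // => z; rewrite inE mc.
have predR z : z \in C i -> exists2 w, w \in C i & succ C w = z := succ_surj pC.
have arcC w : a w (succ C w) by apply: (succ_arc pC); rewrite cC in_setT.
(* The neighbours [u] and [v] come from the dissolved cycle: the predecessor of the first remaining
   vertex and the successor of the last one. *)
have [x [s [u [v [us ps HE s1 [[ui uR aux] [vi vR ayv] uv]]]]]] :
  exists x s u v, [/\ uniq (x :: s), path a x s, ~: covered Y = [set z in x :: s], size s <= 1 &
     [/\ [/\ u \in C i, u \in covered Y & a u x],
         [/\ v \in C i, v \in covered Y & a (last x s) v] & u != v \/ size s = 1]].
  have irrS w : succ C w != w by apply: contraTneq (arcC w) => ->; rewrite airr.
  have S2 w : w \in C i -> succ C (succ C w) != w := succ_succ_neq pC.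
  have [E1|ne1] := eqVneq #|~: covered Y| 1.
    have /cards1P[x Ex] : #|~: covered Y| == 1 by rewrite E1.
    have xi : x \in C i by apply: sR; rewrite Ex set11.
    have [u ui ux] := predR _ xi.
    have inY w : w != x -> w \in covered Y.
      by move=> wx; rewrite -[_ \in _]negbK -in_setC Ex in_set1.
    have uxn : u != x by have := irrS u; rewrite ux eq_sym.
    exists x, [::], u, (succ C x); split=> //.
      by rewrite Ex; apply/setP=> z; rewrite !inE.
    split; [split=> //; [exact: inY | by rewrite -ux; apply: arcC] | split => /= |].
    - by rewrite (succ_mem _ _ pC).
    - exact/inY/irrS.
    - exact: arcC.
    - by left; rewrite -ux eq_sym S2.
  have E2 : #|~: covered Y| = 2.
    have : 0 < #|~: covered Y| by apply/card_gt0P; exists x0.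
    by move: ne1 R2; case: #|_| => [|[|[|]]].
  have [x [y [xR yR xy]]] := card_ge2 (eq_leq (esym E2)).
  have ER : ~: covered Y = [set x; y].
    by apply/esym/eqP; rewrite eqEcard E2 cards2 xy subUset !sub1set xR yR.
  have inY w : w != x -> w != y -> w \in covered Y.
    by move=> wx wy; rewrite -[_ \in _]negbK -in_setC ER in_set2 negb_or wx.
  (* A nonarc among two vertices leaves both relevant degrees zero, where [rest_woodall] asks for a
     sum of two. *)
  have arcR p q : p \in ~: covered Y -> q \in ~: covered Y -> p != q -> a p q.
    move=> pR qR pq; apply: contraT => npq.
    have := rest_woodall airr W pY sY pR qR pq npq.
    have := outin_self2 airr pR qR pq npq; have := inin_self2 airr qR pR; rewrite eq_sym pq npq.
    move=> /(_ isT isT); rewrite E2; degree_lia.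
  have gen p q : p \in ~: covered Y -> q \in ~: covered Y -> p != q ->
      ~: covered Y = [set z in [:: p; q]] -> succ C q != p ->
      exists x s u v, [/\ uniq (x :: s), path a x s, ~: covered Y = [set z in x :: s], size s <= 1 &
     [/\ [/\ u \in C i, u \in covered Y & a u x],
         [/\ v \in C i, v \in covered Y & a (last x s) v] & u != v \/ size s = 1]].
    move=> pR qR pq HE qp; have pi := sR _ pR; have qi := sR _ qR.
    have [u ui up] := predR _ pi; have ap := arcR _ _ pR qR pq.
    have inY' w : w != p -> w != q -> w \in covered Y.
      move=> wp wq; rewrite -[_ \in _]negbK -in_setC HE [_ \in [set _ in _]]inE.
      by rewrite mem_seq2 negb_or wp.
    exists p, [:: q], u, (succ C q); split=> [||//|//|]; [by rewrite /= inE pq | by rewrite /= ap |].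
    split; [split=> // | split => // |by right].
    - apply: inY'; first by have := irrS u; rewrite up eq_sym.
      by apply: contraNneq qp => <-; rewrite up.
    - by rewrite -up arcC.
    - by rewrite (succ_mem _ _ pC).
    - by apply: inY'.
  (* [C i] has at least three vertices, so [x] and [y] cannot each follow the other; the order is
     chosen so that the last one is not followed by the first. *)
  case: (eqVneq (succ C x) y) => sxy.
    apply: (gen x y) => //; last by rewrite -sxy S2 // sR.
    by rewrite ER; apply/setP=> z; rewrite !inE.
  apply: (gen y x) => //; first by rewrite eq_sym.
  by rewrite ER; apply/setP=> z; rewrite !inE orbC.
have [ju uju] := coveredP _ _ uR; have [jv vjv] := coveredP _ _ vR.
have [E|jne] := eqVneq ju jv.
  rewrite E in uju; exact: (close_short airr W pY us ps HE s1 uju vjv aux ayv uv).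
have disl j z : z \in C i -> z \notin C (lift i j).
  move=> zi; apply/negP=> zl; case: pC => _ dC.
  by have := neq_lift i j; rewrite -(dC _ _ _ zi zl) eqxx.
(* Only cycle [j0] of [Y1] holds vertices of [C i], so any found on another cycle were inserted
   later. As [ju] and [jv] differ, one of them is not [j0]. *)
have skip j z : z \in C i -> z \in Y j -> j != j0 -> skippable a Y j z.
  move=> zi zj jj0; case: (QY2 _ _ zj) => // z1.
  have zj0 := inj0 _ zi (mem_covered z1).
  by case: pY1 => _ dY; rewrite (dY _ _ _ z1 zj0) eqxx in jj0.
case: (eqVneq jv j0) => jv0; last first.
  apply: (finish_skip airr W pC cC pY us ps HE s1 vjv ayv (skip _ _ vi vjv jv0) _ (disl _ _ vi)).
  by move=> z /(oth _ jv0); apply: QY1.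
have ju0 : ju != j0 by rewrite -jv0.
apply: (finish_skip_head pC cC pY us ps HE s1 uju aux (skip _ _ ui uju ju0) _ (disl _ _ ui)).
by move=> z /(oth _ ju0); apply: QY1.
Qed.

End FinishBoth.

(** * Dissolving a cycle of a spanning packing *)

Section Reroute.
Variables (V : finType) (a : rel V).
Hypotheses (airr : irreflexive a) (W : woodall a).
Implicit Types (x y u v w p o t : V) (c s P G R Z : seq V).
Variable k : nat.
Implicit Types (C : 'I_k.+1 -> seq V) (Y : 'I_k -> seq V).

(** [C i], opened from [succ C h] to [h], continues with [v :: R]. No arc returns from [v :: R] to
    [C i], so the end of this path has no arc to its head and [splice] applies. *)
Lemma reroute C i h v R Y : packing a C -> h \in C i -> a h v -> uniq (v :: R) -> path a v R ->
  {in v :: R, forall z, z \notin C i} -> {in v :: R & C i, forall p x, ~~ a p x} ->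
  packing a Y -> covered Y = ~: ([set z in C i] :|: [set z in v :: R]) -> has_factor a 'I_k.
Proof.
move=> pC hi ahv uR pR dR nR pY cY.
have [n [r [Er lr pr U]]] := rot_from_succ pC hi.
have mi z : z \in C i = (z \in succ C h :: r) := mem_rot_eq Er z.
have mY z : (z \in covered Y) = (z \notin C i) && (z \notin v :: R).
  by rewrite cY in_setC in_setU [z \in [set _ in C i]]inE [z \in [set _ in _ :: _]]inE negb_or.
have HP : [set z in succ C h :: r] = [set z in C i] by apply/setP=> z; rewrite !in_set mi.
have [|||||C' [pC' cC']] := splice airr W pY (x := succ C h) (s := r) (v := v) (R := R).
- rewrite -cat_cons cat_uniq U uR andbT; apply/hasPn=> z /dR; by rewrite mi.
- by rewrite cat_path pr lr /= ahv.
- move=> z; rewrite -cat_cons mem_cat mY -mi.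
  by case/orP=> ->; rewrite ?andbF.
- by apply: nR; rewrite ?mem_last // mi mem_head.
- rewrite HP [outin _ _ _]outin0 => [|z]; last by rewrite inE => zi; apply: nR; rewrite ?mem_last.
  rewrite [inin _ _ _]inin0 // => z; rewrite in_setD in_setC mY [z \in [set _ in _]]inE.
  by case/andP=> zi; rewrite zi negbK => zR; apply: nR; rewrite // mi mem_head.
exists C'; split=> //; apply/setP=> z; rewrite cC' in_setU mY in_setT.
by rewrite [z \in [set _ in _]]inE -cat_cons mem_cat -mi; case: (z \in C i); case: (z \in v :: R).
Qed.

Section ExitOnly.
Variables (C : 'I_k.+1 -> seq V) (i : 'I_k.+1) (j : 'I_k).
Hypotheses (pC : packing a C) (cC : covered C = setT).
Local Notation D := (C (lift i j)).
Hypothesis noslot : forall x y p, x \in C i -> y \in C i -> p \notin C i ->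
  a p x -> ~~ a y (succ C p).
Hypothesis Dout : {in D & C i, forall p x, ~~ a p x}.

Let dij z : z \in D -> z \notin C i.
Proof.
move=> zl; apply/negP=> zi; case: pC => _ dC.
by have := neq_lift i j; rewrite -(dC _ _ _ zi zl) eqxx.
Qed.

Lemma shrink_packing Z : long_cycle a Z -> {subset Z <= D} ->
  packing a (upd (remove C i) j Z) /\
  forall z, (z \in covered (upd (remove C i) j Z)) = (z \notin C i) && ((z \notin D) || (z \in Z)).
Proof.
move=> gZ sZ; have pR := remove_packing i pC; split.
  apply: upd_packing => // j' z jj' zZ; apply/negP=> zj'; case: pR => _ dR.
  by move/eqP: jj'; apply; apply: dR zj' (sZ _ zZ).
move=> z; rewrite (covered_upd _ _ pR) (covered_remove _ pC) cC in_setU !in_setD in_setT andbT.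
rewrite [z \in [set _ in C i]]inE [z \in [set _ in remove C i j]]inE [z \in [set _ in Z]]inE.
rewrite -[remove C i j]/D; case zZ: (z \in Z); last by rewrite !orbF andbC.
by rewrite !orbT (dij (sZ _ zZ)).
Qed.

(** Write [D] as [v, b, M, d, e]; five vertices make [M] nonempty. Without a factor, [e] has few
    out-neighbours, and the nonarc [(e, b)] forces the arc from [d] to [b]. Then [b, M, d] is a
    cycle, and only [e] and [v] have to be placed besides [C i]. *)
Lemma exit_only v h : v \in D -> h \in C i -> a h v -> 5 <= size D -> has_factor a 'I_k.
Proof.
move=> vD hi ahv sD; have [T Er _] := rot_to_head (packing_uniq _ pC) vD.
have U : uniq (v :: T) by rewrite -Er rot_uniq (packing_uniq _ pC).
have cyD : cycle a (v :: T) by rewrite -Er rot_cycle (packing_cycle _ pC).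
have sT : 4 <= size T by have := sD; rewrite -(size_rot (index v D)) Er.
have mD z : z \in D = (z \in v :: T) := mem_rot_eq Er z.
have {sT Er} [b [M [d [e [M0 ET]]]]] : exists b M d e, M != [::] /\ T = b :: rcons (rcons M d) e.
  case: (T) sT => // b T'; case/lastP: T' => // T' e; case/lastP: T' => // M d.
  by rewrite /= !size_rcons => sM; exists b, M, d, e; split=> //; case: (M) sM.
have eD : e \in D by rewrite mD ET !(inE, mem_rcons) eqxx !orbT.
have bD : b \in D by rewrite mD ET inE mem_head orbT.
have dD : d \in D by rewrite mD ET !(inE, mem_rcons) eqxx !orbT.
have [avb aev] : a v b /\ a e v.
  by move: cyD; rewrite ET /= rcons_path last_rcons => /andP[-> /andP[_ ->]].
have pT : path a b (rcons (rcons M d) e).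
  by move: cyD; rewrite ET (cycle_path v) /= => /and3P[_ _].
have UT : uniq (b :: rcons (rcons M d) e) by move: U; rewrite ET => /andP[].
have vT z : z \in b :: rcons (rcons M d) e -> z != v.
  by move: U; rewrite ET => /andP[vT _] zT; apply: contraNneq vT => <-.
apply: NNPP => nofac.
(* An arc from [e] to [w] cuts off the cycle [Z] from [w] to [e]; the freed path [v :: A] is
   appended to the opened [C i]. *)
have ned w : w \in b :: M -> ~~ a e w.
  move=> wM; apply/negP=> aew; apply: nofac; case/splitPr EM: _ / wM => [A B].
  pose Z := w :: B ++ [:: d; e].
  have ET2 : b :: rcons (rcons M d) e = A ++ Z.
    by rewrite -2!rcons_cons EM -2!cats1 -!catA.
  have UAZ : uniq (A ++ Z) by rewrite -ET2.
  have pvA : path a v (A ++ Z) by rewrite -ET2 /= avb.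
  have gZ : long_cycle a Z.
    apply/and3P; split; first by rewrite /Z /= size_cat /= addn2.
      by move: UAZ; rewrite cat_uniq => /and3P[].
    have pw : path a w (B ++ [:: d; e]) by move: pvA; rewrite (cat_path a v A) => /andP[_ /andP[_]].
    rewrite /Z /= rcons_path last_cat /= aew pw.
    by [].
  have mDZ z : z \in D = (z \in v :: A) || (z \in Z).
    by rewrite mD ET ET2 -cat_cons mem_cat.
  have [|pZ cZ] := shrink_packing gZ; first by move=> z; rewrite mDZ => ->; rewrite orbT.
  have UvA : uniq (v :: A ++ Z) by rewrite -ET2 -ET.
  have dAZ z : z \in v :: A -> z \notin Z.
    by move: UvA; rewrite -cat_cons cat_uniq => /and3P[_ /hasPn hA _] zA; apply: contraTN zA => /hA.
  apply: (reroute pC hi ahv (R := A) _ _ _ _ pZ).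
  - by move: UvA; rewrite -cat_cons cat_uniq => /and3P[].
  - by move: pvA; rewrite cat_path => /andP[].
  - by move=> z zA; apply: dij; rewrite mDZ zA.
  - by move=> p x pA; apply: Dout; rewrite mDZ pA.
  apply/setP=> z; rewrite cZ in_setC in_setU [z \in [set _ in C i]]inE [z \in [set _ in _ :: _]]inE.
  rewrite negb_or mDZ; case zA: (z \in v :: A) => //=.
    by rewrite (negbTE (dAZ _ zA)).
  by rewrite orNb.
have neb : ~~ a e b by apply: ned; rewrite mem_head.
have eb : e != b.
  by move: UT; rewrite /= mem_rcons inE negb_or eq_sym => /andP[/andP[]].
pose Gm := [set z in C i]; pose Dm := [set z in D]; pose B := ~: (Gm :|: Dm).
(* Otherwise the path from [b] to [e] fits behind [q], and only [v] is left; as [e] and [b] are then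
   on one cycle and [v] has arcs from [e] and to [b], [close_short] finishes. *)
have noB q : q \in B -> a q b -> ~~ a e (succ C q).
  rewrite in_setC in_setU [q \in Gm]inE [q \in Dm]inE negb_or => /andP[qi qD] aqb.
  apply/negP=> aeq; apply: nofac.
  pose Y := remove C (lift i j); have pY : packing a Y := remove_packing _ pC.
  have mY z : (z \in covered Y) = (z \notin D).
    by rewrite (covered_remove _ pC) cC in_setD in_setT andbT [z \in [set _ in _]]inE.
  have qY : q \in covered Y by rewrite mY.
  have [jq qjq] := coveredP _ _ qY.
  have dP : {in b :: rcons (rcons M d) e, forall z, z \notin covered Y}.
    by move=> z zT; rewrite mY negbK mD ET inE zT orbT.
  have aeq' : a (last b (rcons (rcons M d) e)) (succ Y q).
    by rewrite last_rcons (succ_remove pC qY).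
  have [pY1 mY1 cY1] := ins_spec pY qjq UT pT dP aqb aeq'.
  set Y1 := ins _ _ _ _ in pY1 mY1 cY1.
  have eY : e \in Y1 jq by rewrite mY1 eqxx -rcons_cons mem_rcons mem_head orbT.
  have bY : b \in Y1 jq by rewrite mY1 eqxx mem_head orbT.
  apply: (close_short airr W pY1 (x := v) (s := [::]) _ _ _ _ eY bY) => //; last by left.
  apply/setP=> z; rewrite in_setC cY1 in_setU mY mD ET [z \in [set _ in _]]inE.
  rewrite [z \in [set _ in [:: v]]]inE mem_seq1 inE.
  by case zT: (z \in b :: _); rewrite ?orbT ?orbF ?negbK //= (negbTE (vT _ zT)).
have cGm : #|Gm| = size (C i) by apply: card_set_seq; apply: packing_uniq pC.
have dis : [disjoint Gm & Dm].
  by rewrite disjoint_sym disjoints_subset; apply/subsetP=> z; rewrite !inE; apply: dij.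
have cGD : #|Gm| + #|Dm| + #|B| = #|V|.
  rewrite -(cardsC (Gm :|: Dm)) cardsU (_ : Gm :&: Dm = set0) ?cards0 ?subn0 //.
  by apply/eqP; rewrite setI_eq0.
have oute w : outdeg a w = outin a w Gm + outin a w Dm + outin a w B.
  by rewrite (outdegC a w (Gm :|: Dm)) outinU.
have inb w : indeg a w = inin a w Gm + inin a w Dm + inin a w B.
  by rewrite (indegC a w (Gm :|: Dm)) ininU.
have sB : inin a b B + outin a e B <= #|B|.
  apply: (slot_count pC) => // p; rewrite !in_setC !in_setU.
  by rewrite ![_ \in Gm]inE ![_ \in Dm]inE !(succ_mem _ _ pC).
have eGm : outin a e Gm = 0 by apply: outin0 => z; rewrite inE => zi; apply: Dout.
have eDm : outin a e Dm <= 2.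
  have <- : #|[set v; d]| = 2.
    by rewrite cards2 eq_sym vT // !(inE, mem_rcons) eqxx !orbT.
  apply/subset_leq_card/subsetP=> z; rewrite in_sep [z \in Dm]inE in_set2 => /andP[zD aez].
  move: zD; rewrite mD ET !(inE, mem_rcons) => /or4P[->//|/eqP zb|/eqP ze|/orP[->|zM]].
  - by move: neb; rewrite -zb aez.
  - by move: aez; rewrite ze airr.
  - by rewrite orbT.
  by have := ned z; rewrite inE zM orbT aez => /(_ isT).
(* Without this arc [b] receives nothing from [b], [d], [e], while [e] has at most two
   out-neighbours in [D]: the degree sum of [(e, b)] would be at most [#|V| - 1]. *)
have adb : a d b.
  apply: contraT => ndb.
  have : inin a b Dm + #|[set b; d; e]| <= #|Dm|.
    apply: inin_avoid; first by apply/subsetP=> z; rewrite !inE => /orP[/orP[]|]/eqP->.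
    by move=> z; rewrite !inE => /orP[/orP[]|]/eqP->; rewrite ?airr.
  have -> : #|[set b; d; e]| = 3.
    move: UT; rewrite /= mem_rcons in_cons mem_rcons in_cons !negb_or rcons_uniq mem_rcons in_cons.
    rewrite negb_or => /and3P[/and3P[be bd _] /andP[ed _] _].
    by rewrite setUC cardsU1 cards2 in_set2 negb_or bd [e == b]eq_sym be ed.
  have := W eb neb; rewrite oute inb eGm; have := inin_le a b Gm.
  move: cGD sB eDm; degree_lia.
pose Z := b :: rcons M d.
have gZ : long_cycle a Z.
  apply/and3P; split.
  - by rewrite /Z /= size_rcons; case: (M) M0.
  - by move: UT; rewrite -rcons_cons rcons_uniq => /andP[].
  by rewrite /Z /= rcons_path last_rcons adb andbT; move: pT; rewrite (rcons_path a b (rcons M d)) => /andP[].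
have mDZ z : z \in D = (z \in Z) || (z \in [:: e; v]).
  rewrite mD ET /Z !(in_cons, mem_rcons, in_nil) orbF.
  by case: (z == v); case: (z == b); case: (z == e); rewrite ?orbT ?orbF.
have sZ : {subset Z <= D} by move=> z zZ; rewrite mDZ zZ.
have vZ z : z \in Z -> z \notin [:: e; v].
  move=> zZ; rewrite mem_seq2 negb_or vT ?andbT; last by rewrite -rcons_cons mem_rcons inE zZ orbT.
  move: UT; rewrite -rcons_cons rcons_uniq => /andP[eZ _].
  by apply: contraNneq eZ => <-.
have [pZ cZ] := shrink_packing gZ sZ.
have ev : e != v by apply: vT; rewrite -rcons_cons mem_rcons mem_head.
(* If [C i] reaches [e], the path [e, v] is appended to it. Otherwise [e] and [C i] are nonadjacent;
   then [e] gets a slot of its own and [v] alone is appended. *)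
case: (classic (exists2 h', h' \in C i & a h' e)) => [[h' h'i ahe]|neI].
  apply: nofac; apply: (reroute pC h'i ahe (R := [:: v]) _ _ _ _ pZ).
  - by rewrite /= inE ev.
  - by rewrite /= aev.
  - by move=> z zR; apply: dij; rewrite mDZ zR orbT.
  - by move=> p x pR; apply: Dout; rewrite mDZ pR orbT.
  apply/setP=> z; rewrite cZ in_setC in_setU [z \in [set _ in C i]]inE [z \in [set _ in _ :: _]]inE.
  rewrite negb_or mDZ; case zZ: (z \in Z); first by rewrite (vZ _ zZ) orbT.
  by rewrite orbF.
set Y := upd _ _ _ in pZ cZ.
have eY : e \notin covered Y.
  rewrite cZ eD /=; apply/negP=> /andP[_ /vZ]; by rewrite mem_head.
(* Without a slot, the nonadjacent vertices [e] and [h] would have total degree at most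
   [2 * #|V| - 2], since [h] has no slot outside [C i] either. *)
have [p [pc ape aep]] : exists p, [/\ p \in covered Y, a p e & a e (succ Y p)].
  apply: NNPP => no; have nosl : inin a e (covered Y) + outin a e (covered Y) <= #|covered Y|.
    apply: (slot_count_covered pZ) => p pc ape; apply/negP=> aep; apply: no; by exists p.
  have eh : e != h by apply: contraTneq hi => <-; apply: dij.
  have := woodall2 W eh (Dout eD hi); case: (boolP (a h e)) => [ahe|_ /(_ isT)].
    by case: neI; exists h.
  have hG : h \in Gm by rewrite inE.
  have shG : inin a h (~: Gm) + outin a h (~: Gm) <= #|~: Gm|.
    apply: (slot_count pC) => p; rewrite !in_setC ![_ \in Gm]inE.
      by rewrite (succ_mem _ _ pC).
    by move=> pi; apply: noslot.
  have sY : covered Y \subset ~: Gm.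
    by apply/subsetP=> z; rewrite cZ in_setC [z \in Gm]inE => /andP[].
  have sev : ~: Gm :\: covered Y = [set e; v].
    apply/setP=> z; rewrite in_setD in_setC [z \in Gm]inE cZ in_set2 mDZ -mem_seq2.
    case zZ: (z \in Z); first by rewrite (negbTE (vZ _ zZ)) /=; case: (z \in C i).
    case zR: (z \in [:: e; v]) => /=; last by case: (z \in C i).
    by rewrite andbF /=; apply: dij; rewrite mDZ zR orbT.
  have oe : outin a e [set e; v] < #|[set e; v]| by apply: outin_self; rewrite // set21.
  have ie : inin a e [set e; v] < #|[set e; v]| by apply: inin_self; rewrite // set21.
  have ceq : #|covered Y| + 2 = #|~: Gm|.
    by rewrite -(cardsID (covered Y) (~: Gm)) (setIidPr sY) sev cards2 ev.
  rewrite !(outdegC a _ Gm) !(indegC a _ Gm) (outinD a e sY) (ininD a e sY) sev eGm.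
  have -> : inin a e Gm = 0.
    by apply: inin0 => z; rewrite inE => zi; apply/negP=> aze; apply: neI; exists z.
  have := outin_self airr hG; have := inin_self airr hG; have := cardsC Gm.
  move: oe ie; rewrite cards2 ev; move: ceq nosl shG; degree_lia.
have [jp pjp] := coveredP _ _ pc.
have [|pY1 _ cY1] := ins_spec pZ pjp (x := e) (s := [::]) isT isT _ ape aep.
  by move=> z; rewrite mem_seq1 => /eqP->.
apply: nofac; apply: (reroute pC hi ahv (R := [::]) _ _ _ _ pY1) => //.
- by move=> z; rewrite mem_seq1 => /eqP->; apply: dij.
- by move=> z x; rewrite mem_seq1 => /eqP-> ; apply: Dout.
apply/setP=> z; rewrite cY1 in_setU cZ in_setC in_setU [z \in [set _ in C i]]inE.
rewrite [z \in [set _ in [:: e]]]inE [z \in [set _ in [:: v]]]inE !mem_seq1 negb_or mDZ mem_seq2.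
have [->|ze] := eqVneq z e; first by rewrite ev (dij eD) orbT.
rewrite orbF /=; case zZ: (z \in Z); last by rewrite orbF.
by rewrite orbT andbT; move: (vZ _ zZ); rewrite mem_seq2 negb_or => /andP[_ ->]; rewrite andbT.
Qed.

End ExitOnly.
End Reroute.

(** * Induction on the size of a smallest cycle *)

Section Contract.
Variables (V : finType) (a : rel V).
Hypotheses (airr : irreflexive a) (W : woodall a).
Implicit Types (x y u v w p o t : V) (c s P G R Z : seq V).
Variable k : nat.
Implicit Types (C : 'I_k.+1 -> seq V) (Y : 'I_k -> seq V).

Lemma entry_only C (i : 'I_k.+1) (j : 'I_k) u h : packing a C -> covered C = setT ->
  (forall x y p, x \in C i -> y \in C i -> p \notin C i -> a p x -> ~~ a y (succ C p)) ->
  {in C (lift i j) & C i, forall p x, ~~ a x p} ->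
  u \in C (lift i j) -> h \in C i -> a u h -> 5 <= size (C (lift i j)) -> has_factor a 'I_k.
Proof.
move=> pC cC noslot Din uD hi auh sD; apply: has_factor_converse.
have pR := packing_converse pC.
apply: (@exit_only _ (converse a) airr (woodall_converse W) k (fun i => rev (C i)) i j
  pR _ _ _ u h) => //; rewrite ?mem_rev ?size_rev ?covered_rev //.
  move=> x y p; rewrite !mem_rev => xi yi pi; apply: contraL; rewrite /converse => ay.
  have sp := succ_rev p pC.
  have := noslot y x (succ (fun i => rev (C i)) p) yi xi; rewrite sp; apply=> //.
  by rewrite -(mem_rev (C i)) (succ_mem _ _ pR) mem_rev.
by move=> p x; rewrite !mem_rev => pD xi; apply: Din.
Qed.

(** Serves for two functions [f]: cardinality, and the number of arcs between a set and two fixed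
    vertices. *)
Lemma covered_subadditive (I : finType) (C : I -> seq V) (f : {set V} -> nat) m :
  f set0 = 0 -> (forall A B, f (A :|: B) <= f A + f B) -> (forall i, f [set x in C i] <= m) ->
  f (covered C) <= #|I| * m.
Proof.
move=> f0 fU hm; have -> : covered C = \bigcup_i [set x in C i].
  apply/setP=> x; apply/coveredP/bigcupP => [[i xi]|[i _]]; first by exists i; rewrite ?inE.
  by rewrite inE; exists i.
rewrite -sum_nat_const; elim/big_rec2: _ => [|i n S _ IH]; first by rewrite f0.
by apply: leq_trans (fU _ _) _; apply: leq_add.
Qed.

Lemma covered_card_le (I : finType) (C : I -> seq V) m :
  (forall i, size (C i) <= m) -> #|covered C| <= #|I| * m.
Proof.
move=> hm; apply: (covered_subadditive (f := fun S => #|S|)) => [|A B|i]; first exact: cards0.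
  exact: leq_card_setU.
rewrite cardsE; exact: leq_trans (card_size _) (hm i).
Qed.

(* If no arc joins C (lift i j) to C i away from o, then consecutive vertices p, succ p other
   than o have few possible neighbours, so the path from succ p to p fits into another cycle. *)
Lemma dissolve C (i : 'I_k.+1) (j : 'I_k) o : packing a C -> covered C = setT ->
  (forall x y p, x \in C i -> y \in C i -> p \notin C i -> a p x -> ~~ a y (succ C p)) ->
  (forall p x, p \in C (lift i j) -> x \in C i -> p != o -> ~~ a p x /\ ~~ a x p) ->
  has_factor a 'I_k.
Proof.
move=> pC cC noslot iso; set D := C (lift i j) in iso.
have dij z : z \in D -> z \notin C i.
  move=> zl; apply/negP=> zi; case: pC => _ dC.
  by have := neq_lift i j; rewrite -(dC _ _ _ zi zl) eqxx.
have irrS z : succ C z != z.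
  have : a z (succ C z) by apply: (succ_arc pC); rewrite cC in_setT.
  by apply: contraTneq => ->; rewrite airr.
have [p [pD po spo]] : exists p, [/\ p \in D, p != o & succ C p != o].
  case: (boolP (o \in D)) => [oD|oD].
    exists (succ C o); rewrite (succ_mem _ _ pC); split=> //; exact: succ_succ_neq pC oD.
  have : 0 < size D by have := packing_size (lift i j) pC; rewrite -/D; case: size.
  case E: D => [|q l] // _; have qD : q \in D by rewrite E mem_head.
  exists q; rewrite -E; split=> //; apply: contraNneq oD => <- //.
  by rewrite (succ_mem _ _ pC).
have [spD siG] : succ C p \in D /\ succ C p \notin C i.
  by rewrite !(succ_mem _ _ pC); split=> //; apply: dij.
apply: NNPP => nofac.
pose Gm := [set z in C i]; pose Dm := [set z in D]; pose B := ~: (Gm :|: Dm).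
have cGm : #|Gm| = size (C i) by apply: card_set_seq; apply: packing_uniq pC.
have dis : [disjoint Gm & Dm].
  by rewrite disjoint_sym disjoints_subset; apply/subsetP=> z; rewrite !inE; apply: dij.
have cGD : #|Gm| + #|Dm| + #|B| = #|V|.
  rewrite -(cardsC (Gm :|: Dm)) cardsU (_ : Gm :&: Dm = set0) ?cards0 ?subn0 //.
  by apply/eqP; rewrite setI_eq0.
have oE w : outdeg a w = outin a w Gm + outin a w Dm + outin a w B.
  by rewrite (outdegC a w (Gm :|: Dm)) outinU.
have iE w : indeg a w = inin a w Gm + inin a w Dm + inin a w B.
  by rewrite (indegC a w (Gm :|: Dm)) ininU.
have Bsucc q : q \in B -> succ C q \in B.
  rewrite !in_setC !in_setU ![_ \in Gm]inE ![_ \in Dm]inE.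
  by rewrite !(succ_mem _ _ pC).
have slp : inin a (succ C p) B + outin a p B <= #|B|.
  apply: (slot_count pC) => // q qB aqs; apply/negP=> aps; apply: nofac.
  move: qB; rewrite in_setC in_setU [q \in Gm]inE [q \in Dm]inE negb_or => /andP[_ qD].
  have [i' qi'] : exists i', q \in C i' by apply/coveredP; rewrite cC in_setT.
  apply: (dissolve_path pC cC pD qi' _ aqs aps).
  by apply: contraNneq qD => E; rewrite /D -E.
have [x xi] : exists x, x \in C i.
  by have := packing_size i pC; case: (C i) => // z l _; exists z; rewrite mem_head.
have slx : inin a x B + outin a x B <= #|B|.
  apply: (slot_count pC) => // q.
  rewrite in_setC in_setU [q \in Gm]inE negb_or => /andP[qi _]; exact: noslot.
have xG : x \in Gm by rewrite inE.
have oD : outin a x Dm <= 1.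
  rewrite -[leqRHS](cards1 o); apply/subset_leq_card/subsetP=> z.
  rewrite in_sep in_set1 [z \in Dm]inE => /andP[zD axz].
  by apply: contraT => zo; have [_] := iso _ _ zD xi zo; rewrite axz.
have iD : inin a x Dm <= 1.
  rewrite -[leqRHS](cards1 o); apply/subset_leq_card/subsetP=> z.
  rewrite in_sep in_set1 [z \in Dm]inE => /andP[zD axz].
  by apply: contraT => zo; have [+ _] := iso _ _ zD xi zo; rewrite axz.
have px : p != x by apply: contraTneq xi => <-; apply: dij.
have xs : x != succ C p by apply: contraNneq siG => <-.
have [npx _] := iso _ _ pD xi po; have [_ nxs] := iso _ _ spD xi spo.
(* The nonarcs [(p, x)] and [(x, succ C p)] have total degree sum at most [2 * #|V| - 2]: the two
   slot counts give [2 * #|B|], and the rest stays inside [D] and [C i] but for two possible arcs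
   between [x] and [o]. *)
have := W px npx; have := W xs nxs; rewrite !oE !iE.
have -> : outin a p Gm = 0.
  by apply: outin0 => z; rewrite inE => zi; have [] := iso _ _ pD zi po.
have -> : inin a (succ C p) Gm = 0.
  by apply: inin0 => z; rewrite inE => zi; have [] := iso _ _ spD zi spo.
have pDm : p \in Dm by rewrite inE.
have sDm : succ C p \in Dm by rewrite inE.
have := outin_self airr pDm; have := inin_self airr sDm.
have := outin_self airr xG; have := inin_self airr xG.
by move: cGD slp slx oD iD; degree_lia.
Qed.

(** If some vertices of a smallest cycle [C i] can move to another cycle, by insertion or along a
    bridge, [finish] applies. Otherwise the arcs between [C i] and any other cycle go in one
    direction only or all meet that other cycle in a single vertex, and a cycle of at least five
    vertices is treated accordingly. *)
Lemma contract C : 0 < k -> 4 * k.+1 < #|V| -> packing a C -> covered C = setT ->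
  has_factor a 'I_k.
Proof.
move=> k0 nV; have [h] := ubnP (size (C ord0)); move: (ord0 : 'I_k.+1) => i.
elim: h C i => // h IH C i0 leh pC cC.
pose i := [arg min_(i < i0) size (C i)].
have [imin lei] : (forall i', size (C i) <= size (C i')) /\ size (C i) <= size (C i0).
  by rewrite /i; case: arg_minnP => // i' _ h'; split=> [i''|]; apply: h'.
have {}IH C' i' : packing a C' -> covered C' = setT -> size (C' i') < size (C i) ->
    has_factor a 'I_k.
  by move=> pC' cC' lt; apply: (IH C' i') => //; lia.
have pY := remove_packing i pC; set Y := remove C i in pY.
have mY z : (z \in covered Y) = (z \notin C i).
  by rewrite (covered_remove _ pC) cC in_setD in_setT andbT [z \in [set _ in _]]inE.
case: (classic (stuck a Y)) => [sY|nsY]; last first.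
  have [x [s [p [us ps [dP pc [apx aly]]]]]] : exists x s p, [/\ uniq (x :: s), path a x s &
      [/\ {in x :: s, forall z, z \notin covered Y}, p \in covered Y &
          a p x /\ a (last x s) (succ Y p)]].
    apply: NNPP => no; apply: nsY => x s p; case/shortenP=> s' ps us ss dP pc apx.
    apply/negP=> aly; apply: no; exists x, s', p; split=> //; split=> //.
    move=> z; rewrite inE => /predU1P[->|/ss zs]; apply: dP; rewrite ?mem_head //.
    by rewrite inE zs orbT.
  have [j pj] := coveredP _ _ pc.
  have [pY1 mY1 cY1] := ins_spec pY pj us ps dP apx aly.
  apply: (finish airr W (j0 := j) pC cC pY1) IH.
  - by move=> z; rewrite in_setC cY1 in_setU mY negb_or negbK => /andP[].
  - exists x; last by rewrite cY1 in_setU [x \in [set _ in _]]inE mem_head orbT.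
    by have := dP x (mem_head x s); rewrite mY negbK.
  - move=> z zi; rewrite cY1 in_setU mY zi /= inE => zP.
    by rewrite mY1 eqxx zP orbT.
  - by move=> j' jj' z zj; rewrite mY1 zj.
case: (classic (exists j u v, [/\ u \in Y j, v \in Y j, u != v &
    u \in into_rest a Y /\ v \in from_rest a Y])) => [[j [u [v [uj vj uv [uO vI]]]]]|nobr].
  have [Y1 [x [s [pY1 dP cY1 oY1 sY1]]]] := bridge_augment airr W pY sY uj vj uv uO vI.
  apply: (finish airr W (j0 := j) pC cC pY1) IH.
  - by move=> z; rewrite in_setC cY1 in_setU mY negb_or negbK => /andP[].
  - exists x; last by rewrite cY1 in_setU [x \in [set _ in _]]inE mem_head orbT.
    by have := dP x (mem_head x s); rewrite mY negbK.
  - by move=> z zi; rewrite cY1 in_setU mY zi /= inE => zP; apply: sY1.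
  - by move=> j' jj'; apply: oY1.
have noslot x y p : x \in C i -> y \in C i -> p \notin C i -> a p x -> ~~ a y (succ C p).
  move=> xi yi pi apx; have pc : p \in covered Y by rewrite mY.
  rewrite -(succ_remove pC pc); apply: (rest_no_slot airr W pY sY _ _ pc apx).
    by rewrite in_setC mY negbK.
  by rewrite in_setC mY negbK.
have Gx x : x \in ~: covered Y -> x \in C i by rewrite in_setC mY negbK.
have xG x : x \in C i -> x \in ~: covered Y by rewrite in_setC mY negbK.
(* If the other cycles had at most four vertices, so would the smallest, and [4 * k.+1] vertices
   would be all. *)
have [j sj] : exists j, 5 <= size (Y j).
  apply: NNPP => no.
  have small j : size (Y j) <= 4 by rewrite leqNgt; apply/negP=> sj; apply: no; exists j.
  suff /covered_card_le : forall i', size (C i') <= 4.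
    by rewrite cC cardsT card_ord; move: nV; card_lia.
  move=> i'; case: (unliftP i i') => [j ->|->]; first exact: small.
  exact: leq_trans (imin (lift i (Ordinal k0))) (small _).
have intoP p x : p \in Y j -> x \in C i -> a p x -> p \in into_rest a Y.
  move=> pj xi apx; apply/into_restP; split; first exact: mem_covered pj.
  by exists x; rewrite // xG.
have fromP p x : p \in Y j -> x \in C i -> a x p -> p \in from_rest a Y.
  move=> pj xi apx; apply/from_restP; split; first exact: mem_covered pj.
  by exists x; rewrite // xG.
have meq u v : u \in Y j -> v \in Y j -> u \in into_rest a Y -> v \in from_rest a Y -> u = v.
  move=> uj vj uO vI; apply/eqP; apply: contraT => uv; case: nobr.
  by exists j, u, v.
case: (classic (exists2 u, u \in Y j & u \in into_rest a Y)) => [[u uj uO]|noO];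
  case: (classic (exists2 v, v \in Y j & v \in from_rest a Y)) => [[v vj vI]|noI].
- have uv := meq _ _ uj vj uO vI; apply: (@dissolve C i j u) => // p x pj xi pu; split.
    by apply: contra pu => /(intoP _ _ pj xi) pO; rewrite (meq _ _ pj vj pO vI) uv.
  by apply: contra pu => /(fromP _ _ pj xi) pI; rewrite (meq _ _ uj pj uO pI).
- have [_ [g gH aug]] := into_restP _ _ _ uO.
  apply: (entry_only pC cC noslot _ uj (Gx _ gH) aug sj) => p x pj xi.
  by apply/negP=> /(fromP _ _ pj xi) pI; apply: noI; exists p.
- have [_ [g gH agv]] := from_restP _ _ _ vI.
  apply: (exit_only airr W pC cC noslot _ vj (Gx _ gH) agv sj) => p x pj xi.
  by apply/negP=> /(intoP _ _ pj xi) pO; apply: noO; exists p.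
have [o oj] : exists o, o \in Y j.
  by have := packing_size j pY; case: (Y j) => // z l _; exists z; rewrite mem_head.
apply: (@dissolve C i j o) => // p x pj xi _; split; apply/negP.
  by move/(intoP _ _ pj xi) => pO; apply: noO; exists p.
by move/(fromP _ _ pj xi) => pI; apply: noI; exists p.
Qed.

End Contract.

(** * Short cycles *)

Section TriangleFree.
Variables (V : finType) (a : rel V).
Hypothesis airr : irreflexive a.
Implicit Types (x y u v w z : V) (A B X : {set V}).

Lemma outin_sum v A : outin a v A = \sum_(u in A) a v u.
Proof.
rewrite /outin -sum1_card big_mkcond [RHS]big_mkcond; apply: eq_bigr => u _.
by rewrite inE; case: (u \in A); case: (a v u).
Qed.
Lemma inin_sum v A : inin a v A = \sum_(u in A) a u v.
Proof.
rewrite /inin -sum1_card big_mkcond [RHS]big_mkcond; apply: eq_bigr => u _.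
by rewrite inE; case: (u \in A); case: (a u v).
Qed.

Definition triangle_free X : Prop :=
  {in X & &, forall x y z, a x y -> a y z -> ~~ a z x}.

(** If [x] and [y] are joined in both directions, any third vertex has at most two arcs with them,
    since more would close a directed triangle; both are deleted. Without such a pair every vertex
    has total degree at most [#|X|]. *)
Lemma triangle_free_arcs X : triangle_free X -> 2 * \sum_(x in X) outin a x X <= #|X| ^ 2.
Proof.
have [n] := ubnP #|X|; elim: n X => // n IH X Xn tf.
case: (classic (exists x y, [/\ x \in X, y \in X, a x y & a y x])) => [[x [y [xX yX axy ayx]]]|nod].
  have xy : x != y by apply: contraTneq axy => ->; rewrite airr.
  pose X' := X :\ x :\ y.
  have yX1 : y \in X :\ x by rewrite in_setD1 eq_sym xy.
  have cX : #|X| = #|X'| + 2 by rewrite (cardsD1 x X) xX (cardsD1 y (X :\ x)) yX1 !add1n addn2.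
  have sumX (f : V -> nat) : \sum_(z in X) f z = f x + f y + \sum_(z in X') f z.
    by rewrite (big_setD1 x xX) (big_setD1 y yX1) /= addnA.
  have X'X z : z \in X' -> z \in X by rewrite !in_setD1 => /and3P[].
  have e u : outin a u X = a u x + a u y + outin a u X' by rewrite !outin_sum sumX.
  have tf' : triangle_free X' by move=> u v w /X'X uX /X'X vX /X'X; apply: tf.
  have IH' : 2 * \sum_(z in X') outin a z X' <= #|X'| ^ 2.
    by apply: IH tf'; move: Xn; rewrite cX; card_lia.
  have le2 : \sum_(z in X') (a z x + a z y) + (outin a x X' + outin a y X') <= 2 * #|X'|.
    rewrite !outin_sum -!big_split /= mulnC -sum_nat_const; apply: leq_sum => z /X'X zX.
    have := tf _ _ _ xX yX zX axy; have := tf _ _ _ yX xX zX ayx.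
    case: (a y z); case: (a x z); case: (a z x); case: (a z y) => //=;
      by [move=> /(_ isT) | move=> _ /(_ isT)].
  have -> : \sum_(u in X) outin a u X =
      2 + (outin a x X' + outin a y X') + (\sum_(z in X') (a z x + a z y) + \sum_(z in X') outin a z X').
    rewrite sumX !e axy ayx !airr -big_split /=; under eq_bigr => z _ do rewrite e.
    by lia.
  move: IH' le2; set s1 := \sum_(z in X') _; set s2 := \sum_(z in X') _.
  rewrite cX !expnS expn0 !muln1; move: (#|X'|) (outin a x X') (outin a y X') => m p q.
  by nia.
have sw : \sum_(x in X) outin a x X = \sum_(x in X) inin a x X.
  under eq_bigr => x _ do rewrite outin_sum.
  by rewrite exchange_big; apply: eq_bigr => x _; rewrite inin_sum.
rewrite mul2n -addnn {2}sw -big_split /= expnS expn1 -sum_nat_const.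
apply: leq_sum => x xX; apply: leq_trans (_ : \sum_(u in X) 1 <= _); last by rewrite sum1_card.
rewrite outin_sum inin_sum -big_split /=; apply: leq_sum => u uX.
case axu : (a x u); case aux: (a u x) => //; case: nod; by exists x, u.
Qed.

Lemma triangle_free_half X : triangle_free X -> X != set0 ->
  exists2 x, x \in X & 2 * outin a x X <= #|X|.
Proof.
move=> tf X0; apply: NNPP => no; have := triangle_free_arcs tf; apply/negP; rewrite -ltnNge.
have lt x : x \in X -> #|X|.+1 <= 2 * outin a x X.
  by move=> xX; rewrite ltnNge; apply/negP=> h; apply: no; exists x.
rewrite big_distrr /=; apply: leq_trans (_ : #|X| * #|X|.+1 <= _); last first.
  by rewrite -sum_nat_const; apply: leq_sum.
by rewrite expnS expn1 ltn_mul2l ltnSn andbT card_gt0.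
Qed.

End TriangleFree.

Lemma triangle_free_half_in (V : finType) (a : rel V) (X : {set V}) :
  irreflexive a -> triangle_free a X -> X != set0 ->
  exists2 x, x \in X & 2 * inin a x X <= #|X|.
Proof.
move=> airr tf X0; apply: (@triangle_free_half _ (converse a) airr X _ X0).
move=> x y z xX yX zX; rewrite /converse => ayx azy; apply/negP=> axz.
by have := tf _ _ _ zX yX xX azy ayx; rewrite axz.
Qed.

(** * Short paths that many vertices can close *)

Section PathThrough.
Variables (V : finType) (a : rel V).
Hypotheses (airr : irreflexive a) (W : woodall a).
Implicit Types (x y u v w z : V) (A B X F U : {set V}).

(** The vertices outside [U] that turn a path from [x] to [z] inside [U] into a cycle. *)
Definition closers U x z := [set c in ~: U | a z c && a c x].

Lemma closers_count U x z : z != x -> ~~ a z x ->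
  #|U| <= #|closers U x z| + (outin a z U + inin a x U).
Proof.
move=> zx nzx; have := W zx nzx; rewrite (outdegC a z U) (indegC a x U).
have : outin a z (~: U) + inin a x (~: U) <= #|closers U x z| + #|~: U|.
  rewrite /outin /inin -cardsUI addnC; apply: leq_add.
    by apply/subset_leq_card/subsetP=> c; rewrite !in_setI !in_sep => /andP[/andP[-> ->] /andP[_ ->]].
  by apply/subset_leq_card/subsetP=> c; rewrite in_setU !in_sep => /orP[]/andP[].
have := cardsC U; degree_lia.
Qed.

Section InU.
Variable U : {set V}.
Hypothesis tfU : triangle_free a U.
Hypothesis no4 : forall x y z v, x \in U -> y \in U -> z \in U -> v \in U ->
  x != z -> y != v -> a x y -> a y z -> a z v -> ~~ a v x.

Let sub_tf X : X \subset U -> triangle_free a X.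
Proof. by move=> /subsetP sX x y z /sX xU /sX yU /sX; apply: tfU. Qed.

(** No arc leads from an out-neighbour of [y] to an in-neighbour, as it would close a triangle. In
    the path [x, y, z] the ends are chosen with few arcs into the neighbourhood of [y]; their
    neighbourhoods in [U] are then small, and [closers_count] gives many closers. If [F] swallows
    one side of the neighbourhood, [y] itself is an end. [F] will be the vertex set of another
    path. *)
Lemma path_through y F : y \in U -> y \notin F ->
  2 * #|F| + 3 <= outin a y U + inin a y U ->
  exists x s, [/\ uniq (x :: s), path a x s, 0 < size s <= 2, y \in x :: s &
    {in x :: s, forall z, [/\ z \in U, z \notin F & [\/ z = y, a y z | a z y]]} /\
    outin a y U + inin a y U <= 2 * #|closers U x (last x s)| + 2 + 2 * #|F|].
Proof.
move=> yU yF dy.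
pose A := [set z in U | a y z]; pose B := [set z in U | a z y].
have mA z : (z \in A) = (z \in U) && a y z by rewrite inE.
have mB z : (z \in B) = (z \in U) && a z y by rewrite inE.
have AB z x : z \in A -> x \in B -> ~~ a z x.
  by rewrite mA mB => /andP[zU ayz] /andP[xU axy]; apply/negP=> azx;
     have := tfU xU yU zU axy ayz; rewrite azx.
have yA : y \notin A by rewrite mA airr andbF.
have yB : y \notin B by rewrite mB airr andbF.
have sA : A \subset U by apply/subsetP=> z; rewrite mA => /andP[].
have sB : B \subset U by apply/subsetP=> z; rewrite mB => /andP[].
have dAB : outin a y U + inin a y U = #|A| + #|B| by [].
rewrite dAB in dy *.
have cDF X : #|X| <= #|X :\: F| + #|F|.
  by rewrite -(cardsID F X) addnC leq_add2l subset_leq_card ?subsetIr.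
have arcN u v : a u v -> u != v by apply: contraTneq => ->; rewrite airr.
case: (boolP (A \subset F)) => [sAF|nAF].
  have B0 : B :\: F != set0.
    rewrite -card_gt0; have := cDF B; have := subset_leq_card sAF.
    by move: dy; card_lia.
  have sBF : B :\: F \subset U by apply: subset_trans sB; apply: subsetDl.
  have [x] := triangle_free_half_in airr (sub_tf sBF) B0.
  rewrite in_setD mB => /and3P[xF xU axy] hx.
  have nyx : ~~ a y x.
    by apply: contra xF => ayx; apply: (subsetP sAF); rewrite mA xU.
  exists x, [:: y]; split=> //=; rewrite ?axy ?inE ?(arcN _ _ axy) ?eqxx ?orbT //; split.
    by move=> z; rewrite !inE => /orP[]/eqP->; split=> //; [apply: Or33 | apply: Or31].
  have yx : y != x by rewrite eq_sym arcN.
  have := closers_count U yx nyx.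
  have : inin a x U + #|A :|: [set y]| <= #|U| - #|B :\: F| + inin a x (B :\: F).
    rewrite (ininD _ _ sBF) addnAC leq_add2r.
    have -> : #|U| - #|B :\: F| = #|U :\: (B :\: F)| by rewrite [RHS]cardsD (setIidPr sBF).
    apply: inin_avoid.
      apply/subsetP=> z /setUP[zA|/set1P->]; rewrite !in_setD.
        by rewrite (subsetP sAF z zA) (subsetP sA z zA).
      by rewrite yU (negbTE yB) andbF.
    by move=> z /setUP[zA|/set1P->] //; apply: AB; rewrite // mB xU.
  rewrite setUC cardsU1 yA; have := subset_leq_card sBF; have := subset_leq_card sAF; have := cDF B.
  have -> : outin a y U = #|A| by [].
  move: hx; degree_lia.
case: (boolP (B \subset F)) => [sBF|nBF].
  have A0 : A :\: F != set0.
    by rewrite -card_gt0 card_gt0; apply: contra nAF; rewrite setD_eq0.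
  have sAF : A :\: F \subset U by apply: subset_trans sA; apply: subsetDl.
  have [z] := triangle_free_half airr (sub_tf sAF) A0.
  rewrite in_setD mA => /and3P[zF zU ayz] hz.
  have nzy : ~~ a z y.
    by apply: contra zF => azy; apply: (subsetP sBF); rewrite mB zU.
  exists y, [:: z]; split=> //=; rewrite ?ayz ?inE ?(arcN _ _ ayz) ?eqxx ?orbT //; split.
    by move=> t; rewrite !inE => /orP[]/eqP->; split=> //; [apply: Or31 | apply: Or32].
  have zy : z != y by rewrite eq_sym arcN.
  have := closers_count U zy nzy.
  have : outin a z U + #|B :|: [set y]| <= #|U| - #|A :\: F| + outin a z (A :\: F).
    rewrite (outinD _ _ sAF) addnAC leq_add2r.
    have -> : #|U| - #|A :\: F| = #|U :\: (A :\: F)| by rewrite [RHS]cardsD (setIidPr sAF).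
    apply: outin_avoid.
      apply/subsetP=> t /setUP[tB|/set1P->]; rewrite !in_setD.
        by rewrite (subsetP sBF t tB) (subsetP sB t tB).
      by rewrite yU (negbTE yA) andbF.
    by move=> t /setUP[tB|/set1P->] //; apply: AB; rewrite // mA zU.
  rewrite setUC cardsU1 yB; have := subset_leq_card sAF; have := subset_leq_card sBF; have := cDF A.
  have -> : inin a y U = #|B| by [].
  move: hz; degree_lia.
pose P := (A :\: B) :\: F; pose Q := (B :\: A) :\: F; pose T := A :&: B.
have sPU : P \subset U by apply: subset_trans sA; rewrite /P setDDl; apply: subsetDl.
have sQU : Q \subset U by apply: subset_trans sB; rewrite /Q setDDl; apply: subsetDl.
have cAB : #|A| + #|B| <= 2 * #|T| + #|P| + #|Q| + 2 * #|F|.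
  have := cDF (A :\: B); have := cDF (B :\: A); rewrite -/P -/Q.
  have := cardsID B A; have := cardsID A B; rewrite [B :&: A]setIC -/T; card_lia.
(* Where [P] or [Q] is empty its halving bound is free. If both are, [A] and [B] agree outside [F]
   and have two vertices there, by the [+ 3] in the degree hypothesis, so that [z != x] can be
   ensured. *)
have [z [x [zA xB zx [zF xF] [hz hx]]]] : exists z x, [/\ z \in A, x \in B, z != x,
   z \notin F /\ x \notin F & 2 * outin a z P <= #|P| /\ 2 * inin a x Q <= #|Q|].
  have zP : P != set0 -> exists z, [/\ z \in A, z \notin F, z \notin B & 2 * outin a z P <= #|P|].
    move=> P0; have [z] := triangle_free_half airr (sub_tf sPU) P0.
    by rewrite !in_setD => /and3P[zF zB zA] hz; exists z.
  have xQ : Q != set0 -> exists x, [/\ x \in B, x \notin F, x \notin A & 2 * inin a x Q <= #|Q|].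
    move=> Q0; have [x] := triangle_free_half_in airr (sub_tf sQU) Q0.
    by rewrite !in_setD => /and3P[xF xA xB] hx; exists x.
  have [P0|/zP[z [zA zF zB hz]]] := eqVneq P set0; last first.
    have [Q0|/xQ[x [xB xF xA hx]]] := eqVneq Q set0; last first.
      by exists z, x; split=> //; apply: contraNneq zB => ->.
    have /subsetPn[x xB xF] := nBF.
    exists z, x; split=> //; first by apply: contraNneq zB => ->.
    by rewrite Q0 cards0 [inin _ _ _]inin0 // => t; rewrite inE.
  have zero z : 2 * outin a z P <= #|P|.
    by rewrite P0 cards0 [outin _ _ _]outin0 // => t; rewrite inE.
  have AsubB z : z \in A -> z \notin F -> z \in B.
    move=> zA zF; apply: contraT => zB; have : z \in P by rewrite !in_setD zF zB.
    by rewrite P0 inE.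
  have [Q0|/xQ[x [xB xF xA hx]]] := eqVneq Q set0; last first.
    have /subsetPn[z zA zF] := nAF.
    by exists z, x; split=> //; apply: contraNneq xA => <-.
  have zeroQ x : 2 * inin a x Q <= #|Q|.
    by rewrite Q0 cards0 [inin _ _ _]inin0 // => t; rewrite inE.
  have EAB : A :\: F = B :\: F.
    apply/setP=> t; rewrite !in_setD; case tF: (t \in F) => //=.
    apply/idP/idP => [tA|tB]; first by apply: AsubB; rewrite ?tF.
    apply: contraT => tA; have : t \in Q by rewrite !in_setD tF tA.
    by rewrite Q0 inE.
  have two : 1 < #|A :\: F|.
    by have := cDF A; have := cDF B; rewrite -EAB; move: dy; card_lia.
  have [z [x [zAF xAF zx]]] := card_ge2 two.
  have := xAF; rewrite EAB in_setD => /andP[xF xB].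
  by move: zAF; rewrite in_setD => /andP[zF zA]; exists z, x.
have [zU ayz] : z \in U /\ a y z by apply/andP; rewrite -mA.
have [xU axy] : x \in U /\ a x y by apply/andP; rewrite -mB.
have nzx := AB _ _ zA xB.
exists x, [:: y; z]; split=> //=; rewrite ?axy ?ayz ?inE ?eqxx ?orbT //.
  by rewrite negb_or (arcN _ _ axy) (arcN _ _ ayz) eq_sym zx.
split.
  move=> t; rewrite !inE => /or3P[]/eqP->; split=> //.
  - exact: Or33.
  - exact: Or31.
  - exact: Or32.
have := closers_count U zx nzx.
pose K := [set t in U | a z t]; pose L := [set t in U | a t x].
(* A common vertex other than [y] would close [x, y, z] to a cycle of length four. *)
have KL : #|K :&: L| <= 1.
  rewrite -[leqRHS](cards1 y); apply/subset_leq_card/subsetP=> t; rewrite in_setI !in_sep in_set1.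
  case/andP=> /andP[tU azt] /andP[_ atx]; apply: contraT => ty.
  have xz : x != z by rewrite eq_sym.
  have yt : y != t by rewrite eq_sym.
  by have := no4 xU yU zU tU xz yt axy ayz azt; rewrite atx.
(* [K] misses [B] and [L] misses [A], so their union misses [T], meets [P] only in out-neighbours of
   [z], and meets [Q] only in in-neighbours of [x]. *)
have KLU : #|K :|: L| + (#|T| + #|P| + #|Q|) <= #|U| + (outin a z P + inin a x Q).
  have KP : (K :|: L) :&: P \subset [set t in P | a z t].
    apply/subsetP=> t; rewrite in_setI in_setU !in_sep => /andP[+ tP]; rewrite tP /=.
    case/orP=> /andP[tU //] atx; have tA : t \in A by move: tP; rewrite !in_setD => /and3P[].
    by have := AB _ _ tA xB; rewrite atx.
  have LQ : (K :|: L) :&: Q \subset [set t in Q | a t x].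
    apply/subsetP=> t; rewrite in_setI in_setU !in_sep => /andP[+ tQ]; rewrite tQ /=.
    case/orP=> /andP[tU //] azt; have tB : t \in B by move: tQ; rewrite !in_setD => /and3P[].
    by have := AB _ _ zA tB; rewrite azt.
  have TKL : (K :|: L) :&: T = set0.
    apply/setP=> t; rewrite in_setI in_setU [t \in K]in_sep [t \in L]in_sep in_setI in_set0; apply/negP.
    case/andP=> /orP[/andP[_ azt]|/andP[_ atx]] /andP[tA tB].
      by have := AB _ _ zA tB; rewrite azt.
    by have := AB _ _ tA xB; rewrite atx.
  have QP : Q :&: P = set0.
    apply/setP=> t; rewrite in_setI !in_setD in_set0.
    by case: (t \in A); case: (t \in B); rewrite ?andbF.
  have TPQ : T :&: (P :|: Q) = set0.
    apply/setP=> t; rewrite in_setI in_setU !in_setD in_set0 in_setI.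
    by case: (t \in A); case: (t \in B); rewrite ?andbF.
  have sum3 : #|T :|: (P :|: Q)| = #|T| + #|P| + #|Q|.
    by rewrite cardsU TPQ cards0 subn0 cardsU [P :&: Q]setIC QP cards0 subn0 addnA.
  have sU : (K :|: L) :|: (T :|: (P :|: Q)) \subset U.
    rewrite !subUset sPU sQU (subset_trans (subsetIl A B) sA) !andbT.
    by apply/andP; split; apply/subsetP=> t; rewrite in_sep => /andP[].
  have := subset_leq_card sU; have := cardsUI (K :|: L) (T :|: (P :|: Q)); rewrite sum3.
  have : #|(K :|: L) :&: (T :|: (P :|: Q))| <= outin a z P + inin a x Q.
    rewrite setIUr TKL set0U setIUr; apply: leq_trans (leq_card_setU _ _) _.
    by apply: leq_add; apply: subset_leq_card.
  degree_lia.
have := cardsUI K L; rewrite -[#|K|]/(outin a z U) -[#|L|]/(inin a x U).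
by move: KL KLU hz hx cAB; degree_lia.
Qed.

End InU.
End PathThrough.

(** * Greedy construction of short cycles *)

Section ShortPacking.
Variables (V : finType) (a : rel V).
Hypotheses (airr : irreflexive a) (W : woodall a).
Implicit Types (x y u v w z p q : V) (c s : seq V) (A B X F U : {set V}).

Lemma arc_neq x y : a x y -> x != y.
Proof. by apply: contraTneq => ->; rewrite airr. Qed.

Lemma outin_seq y c : uniq c -> outin a y [set z in c] = \sum_(z <- c) a y z.
Proof. by move=> uc; rewrite outin_sum big_uniq //; apply: eq_bigl => z; rewrite inE. Qed.
Lemma inin_seq y c : uniq c -> inin a y [set z in c] = \sum_(z <- c) a z y.
Proof. by move=> uc; rewrite inin_sum big_uniq //; apply: eq_bigl => z; rewrite inE. Qed.

Section Step.
Variables (j : nat) (C : 'I_j -> seq V).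
Hypotheses (pC : packing a C) (C4 : forall i, size (C i) <= 4).
Hypothesis noext : forall C' : 'I_j.+1 -> seq V, packing a C' ->
  ~ (forall i, size (C' i) <= 4).
Local Notation U := (~: covered C).

Lemma no_short c : long_cycle a c -> size c <= 4 -> ~ {in c, forall z, z \in U}.
Proof.
move=> gc sc cU; have [|pA _] := add_packing pC gc; first by move=> z /cU; rewrite in_setC.
by apply: (noext pA) => i; rewrite /add_cycle; case: unliftP => [i' _|_].
Qed.

Lemma no_two i c1 c2 : long_cycle a c1 -> long_cycle a c2 -> size c1 <= 4 -> size c2 <= 4 ->
  {in c1, forall z, z \in C i \/ z \in U} -> {in c2, forall z, z \in C i \/ z \in U} ->
  ~ {in c1, forall z, z \notin c2}.
Proof.
move=> g1 g2 s1 s2 h1 h2 dis.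
have pU : packing a (upd C i c1).
  apply: upd_packing => // i' z ii' /h1[zi|]; last first.
    by rewrite in_setC; apply: contra; apply: mem_covered.
  by apply/negP=> zi'; case: pC => _ dC; rewrite (dC _ _ _ zi zi') eqxx in ii'.
have [|pA _] := add_packing pU g2.
  move=> z z2; rewrite (covered_upd _ _ pC) in_setU in_setD [z \in [set _ in C i]]inE.
  rewrite [z \in [set _ in c1]]inE; apply/norP; split; last by apply: contraL z2; apply: dis.
  by case: (h2 _ z2) => [->//|]; rewrite in_setC => /negbTE->; rewrite andbF.
apply: (noext pA) => i'; rewrite /add_cycle; case: unliftP => [i'' _|_] //.
by rewrite /upd; case: ifP.
Qed.

Lemma triangle_cycle x y z : a x y -> a y z -> a z x -> long_cycle a [:: x; y; z].
Proof.
move=> xy yz zx; rewrite /long_cycle /= !inE xy yz zx negb_or (arc_neq xy) (arc_neq yz).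
by rewrite eq_sym (arc_neq zx).
Qed.

Lemma rest_triangle_free : triangle_free a U.
Proof.
move=> x y z xU yU zU xy yz; apply/negP=> zx.
apply: (no_short (triangle_cycle xy yz zx)) => // t.
by rewrite !in_cons in_nil orbF => /or3P[]/eqP->.
Qed.

Lemma rest_no4 x y z v : x \in U -> y \in U -> z \in U -> v \in U ->
  x != z -> y != v -> a x y -> a y z -> a z v -> ~~ a v x.
Proof.
move=> xU yU zU vU xz yv xy yz zv; apply/negP=> vx.
apply: (@no_short [:: x; y; z; v]) => //.
  rewrite /long_cycle /= !inE !negb_or xy yz zv vx xz yv !(arc_neq xy) (arc_neq yz) (arc_neq zv).
  by rewrite eq_sym (arc_neq vx).
by move=> t; rewrite !in_cons in_nil orbF => /or4P[]/eqP->.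
Qed.

(** For a triangle twelve is all there is. On a 4-cycle, two disjoint arcs cannot be closed to
    triangles, one by [y1] and the other by [y2], so one of the four arcs involved is missing. The
    four ways to assign disjoint arcs to [y1] and [y2] count each of the sixteen possible arcs
    once. *)
Lemma cycle_degree y1 y2 i : y1 \in U -> y2 \in U -> y1 != y2 ->
  (outin a y1 [set z in C i] + inin a y1 [set z in C i]) +
  (outin a y2 [set z in C i] + inin a y2 [set z in C i]) <= 12.
Proof.
move=> y1U y2U y12; have uC := packing_uniq i pC.
case: (leqP (size (C i)) 3) => [s3|s4].
  have cc := card_set_seq uC.
  have := outin_le a y1 [set z in C i]; have := outin_le a y2 [set z in C i].
  have := inin_le a y1 [set z in C i]; have := inin_le a y2 [set z in C i].
  by rewrite cc; move: s3; degree_lia.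
have [c0 [c1 [c2 [c3 E]]]] : exists c0 c1 c2 c3 : V, C i = [:: c0; c1; c2; c3].
  have := C4 i; move: s4; case: (C i) => [|c0 [|c1 [|c2 [|c3 []]]]] // _ _.
  by exists c0, c1, c2, c3.
have cU z : z \in U -> z \notin C i.
  by rewrite in_setC; apply: contra; apply: mem_covered.
have yE y z : y \in U -> z \in C i -> y != z.
  by move=> /cU yi zi; apply: contraNneq yi => ->.
have combo (p q r t : V) : a p q -> a r t -> p \in C i -> q \in C i -> r \in C i -> t \in C i ->
    p != r -> p != t -> q != r -> q != t ->
    a q y1 + a y1 p + (a t y2 + a y2 r) <= 3.
  move=> pq rs pi qi ri ti pr ps qr qs; rewrite leqNgt; apply/negP=> lt3.
  have [[q1 p1] [s2 r2]] : (a q y1 /\ a y1 p) /\ (a t y2 /\ a y2 r).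
    by move: lt3; do 4 case: (a _ _).
  apply: (@no_two i _ _ (triangle_cycle pq q1 p1) (triangle_cycle rs s2 r2)) => // z.
  - by rewrite !in_cons in_nil orbF => /or3P[]/eqP->; auto.
  - by rewrite !in_cons in_nil orbF => /or3P[]/eqP->; auto.
  rewrite !in_cons in_nil !orbF => /or3P[]/eqP->; rewrite !negb_or.
  - by rewrite pr ps eq_sym yE.
  - by rewrite qr qs eq_sym yE.
  - by rewrite y12 !yE.
have mi z : z \in [:: c0; c1; c2; c3] -> z \in C i by rewrite E.
have m0 : c0 \in C i by rewrite mi ?inE ?eqxx.
have m1 : c1 \in C i by rewrite mi ?inE ?eqxx ?orbT.
have m2 : c2 \in C i by rewrite mi ?inE ?eqxx ?orbT.
have m3 : c3 \in C i by rewrite mi ?inE ?eqxx ?orbT.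
have := packing_cycle i pC; rewrite E /= => /and5P[a01 a12 a23 a30 _].
have := uC; rewrite E /= !inE !negb_or => /and4P[/and3P[n01 n02 n03] /andP[n12 n13] n23 _].
have n10 : c1 != c0 by rewrite eq_sym.
have n20 : c2 != c0 by rewrite eq_sym.
have n30 : c3 != c0 by rewrite eq_sym.
have n21 : c2 != c1 by rewrite eq_sym.
have n31 : c3 != c1 by rewrite eq_sym.
have n32 : c3 != c2 by rewrite eq_sym.
have := combo c0 c1 c2 c3 a01 a23 m0 m1 m2 m3 n02 n03 n12 n13.
have := combo c1 c2 c3 c0 a12 a30 m1 m2 m3 m0 n13 n10 n23 n20.
have := combo c2 c3 c0 c1 a23 a01 m2 m3 m0 m1 n20 n21 n30 n31.
have := combo c3 c0 c1 c2 a30 a12 m3 m0 m1 m2 n31 n32 n01 n02.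
have uE : uniq [:: c0; c1; c2; c3] by rewrite -E.
rewrite !outin_seq // !inin_seq // !big_cons !big_nil.
move: (nat_of_bool (a c0 y1)) (nat_of_bool (a c1 y1)) (nat_of_bool (a c2 y1)) (nat_of_bool (a c3 y1)).
move: (nat_of_bool (a y1 c0)) (nat_of_bool (a y1 c1)) (nat_of_bool (a y1 c2)) (nat_of_bool (a y1 c3)).
move: (nat_of_bool (a c0 y2)) (nat_of_bool (a c1 y2)) (nat_of_bool (a c2 y2)) (nat_of_bool (a c3 y2)).
move: (nat_of_bool (a y2 c0)) (nat_of_bool (a y2 c1)) (nat_of_bool (a y2 c2)) (nat_of_bool (a y2 c3)).
by clear; lia.
Qed.

Lemma closing_cycle x s (c : V) : uniq (x :: s) -> path a x s -> 0 < size s <= 2 ->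
  {in x :: s, forall z, z \in U} -> c \in closers a U x (last x s) -> long_cycle a (c :: x :: s).
Proof.
move=> us ps sz sU; rewrite in_sep setCK => /andP[cc /andP[zc cx]].
apply/and3P; split; first by rewrite /=; case/andP: sz.
  by rewrite cons_uniq us andbT; apply: contraTN cc => /sU; rewrite in_setC.
by rewrite /= cx rcons_path ps zc.
Qed.

(** If [c] closes the first path and its predecessor on the same cycle closes the second, that cycle
    can be exchanged for two. So [succ C] maps the closers of the second path off those of the
    first. *)
Lemma no_two_paths x1 s1 x2 s2 :
  uniq (x1 :: s1) -> path a x1 s1 -> 0 < size s1 <= 2 -> {in x1 :: s1, forall z, z \in U} ->
  uniq (x2 :: s2) -> path a x2 s2 -> 0 < size s2 <= 2 -> {in x2 :: s2, forall z, z \in U} ->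
  {in x2 :: s2, forall z, z \notin x1 :: s1} ->
  #|closers a U x1 (last x1 s1)| + #|closers a U x2 (last x2 s2)| <= #|covered C|.
Proof.
move=> u1 p1 z1 U1 u2 p2 z2 U2 dis; set S1 := closers _ _ _ _; set S2 := closers _ _ _ _.
have sub x z (c : V) : c \in closers a U x z -> c \in covered C.
  by rewrite in_sep setCK => /andP[].
rewrite -(card_imset S2 (succ_inj pC)) -cardsUI (_ : _ :&: _ = set0) ?cards0 ?addn0.
  apply/subset_leq_card/subsetP=> c /setUP[/sub//|/imsetP[q qS ->]].
  by rewrite (succ_covered _ pC) (sub _ _ _ qS).
apply/setP=> c; rewrite in_setI in_set0; apply/negP=> /andP[cS1 /imsetP[q qS2 cq]].
have [i qi] := coveredP _ _ (sub _ _ _ qS2).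
have ci : c \in C i by rewrite cq (succ_mem _ _ pC).
have nqc : q != c by rewrite cq arc_neq // (succ_arc pC) // (mem_covered qi).
have cU z : z \in C i -> z \notin U by move=> zi; rewrite in_setC negbK (mem_covered zi).
apply: (@no_two i (c :: x1 :: s1) (q :: x2 :: s2)).
- exact: closing_cycle u1 p1 z1 U1 cS1.
- exact: closing_cycle u2 p2 z2 U2 qS2.
- by case/andP: z1.
- by case/andP: z2.
- by move=> z; rewrite inE => /predU1P[->|/U1]; auto.
- by move=> z; rewrite inE => /predU1P[->|/U2]; auto.
move=> z; rewrite in_cons [z \in q :: _]in_cons negb_or => /predU1P[->|z1'].
  by rewrite eq_sym nqc; apply: contra (cU _ ci) => /U2.
apply/andP; split; first by apply: contraTneq (U1 _ z1') => ->; apply: cU.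
by apply: contraL z1'; apply: dis.
Qed.

(** Two vertices of large degree in [U] lead to disjoint paths with more closers than [no_two_paths]
    allows. They are either a nonadjacent pair, at most [12 * j] of whose arcs go to the cycles, or,
    if [U] has no such pair, almost arbitrary. *)
Lemma step_contra k : 1 < k -> j <= k -> 12 * k + 3 <= #|V| -> False.
Proof.
move=> k2 jk nV; have w4 : #|covered C| <= j * 4 by have := covered_card_le C4; rewrite card_ord.
have cU := cardsC (covered C).
pose d y := outin a y U + inin a y U.
have path0 y : y \in U -> 3 <= d y -> exists x s, [/\ uniq (x :: s), path a x s,
    0 < size s <= 2, y \in x :: s & {in x :: s, forall z, z \in U /\ [\/ z = y, a y z | a z y]} /\
    d y <= 2 * #|closers a U x (last x s)| + 2].
  move=> yU dy; have [||x [s [us ps sz ys [sU cl]]]] := path_through airr W rest_triangle_free rest_no4 yU (F := set0).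
  - by rewrite inE.
  - by rewrite cards0.
  exists x, s; split=> //; split; first by move=> z /sU[].
  by move: cl; rewrite cards0 muln0 addn0.
have clle x z : #|closers a U x z| <= #|covered C|.
  by apply/subset_leq_card/subsetP=> c; rewrite in_sep setCK => /andP[].
(* Avoiding at most three vertices costs the second path [2 * 3], and each path loses 2, so the
   degrees could total at most [2 * #|covered C| + 10]. The bound 9 is [2 * 3 + 3] from
   [path_through]. *)
have main x1 s1 y2 m : uniq (x1 :: s1) -> path a x1 s1 -> 0 < size s1 <= 2 ->
    {in x1 :: s1, forall z, z \in U} -> m <= 2 * #|closers a U x1 (last x1 s1)| + 2 ->
    y2 \in U -> y2 \notin x1 :: s1 -> 9 <= d y2 -> 2 * #|covered C| + 11 <= m + d y2 -> False.
  move=> u1 p1 z1 U1 c1 y2U y2n d2 sum.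
  have cF : #|[set z in x1 :: s1]| <= 3 by rewrite (card_set_seq u1); case/andP: z1.
  have [||x2 [s2 [u2 p2 z2 _ [U2 c2]]]] := path_through airr W rest_triangle_free rest_no4 y2U (F := [set z in x1 :: s1]).
  - by rewrite inE.
  - by apply: leq_trans d2; move: cF; card_lia.
  have U2' : {in x2 :: s2, forall z, z \in U} by move=> z /U2[].
  have D2 : {in x2 :: s2, forall z, z \notin x1 :: s1} by move=> z /U2[_ + _]; rewrite inE.
  have := no_two_paths u1 p1 z1 U1 u2 p2 z2 U2' D2.
  move: c1 c2 cF sum; rewrite -/(d y2); move: (d y2) => d2'; card_lia.
have alone y : y \in U -> 3 <= d y -> d y <= 2 * #|covered C| + 2.
  move=> yU dy; have [x [s [_ _ _ _ [_ cl]]]] := path0 y yU dy.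
  by have := clle x (last x s); move: cl; move: (d y) => dy'; card_lia.
case: (classic (exists y1 y2, [/\ y1 \in U, y2 \in U, y1 != y2 & ~~ a y1 y2 /\ ~~ a y2 y1])).
  case=> y1 [y2 [y1U y2U y12 [n12 n21]]].
  have dsum : 2 * #|V| <= j * 12 + (d y1 + d y2).
    pose f S := (outin a y1 S + inin a y1 S) + (outin a y2 S + inin a y2 S).
    have : f (covered C) <= j * 12.
      rewrite -[j in leqRHS]card_ord; apply: covered_subadditive => [|A B|i].
      - by rewrite /f !(outin0, inin0) // => z; rewrite inE.
      - have oU y : outin a y (A :|: B) <= outin a y A + outin a y B.
          rewrite /outin (_ : [set u in A :|: B | a y u] =
            [set u in A | a y u] :|: [set u in B | a y u]); first exact: leq_card_setU.
          by apply/setP=> z; rewrite in_setU !in_sep in_setU andb_orl.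
        have iU y : inin a y (A :|: B) <= inin a y A + inin a y B.
          rewrite /inin (_ : [set u in A :|: B | a u y] =
            [set u in A | a u y] :|: [set u in B | a u y]); first exact: leq_card_setU.
          by apply/setP=> z; rewrite in_setU !in_sep in_setU andb_orl.
        by rewrite /f; have := oU y1; have := oU y2; have := iU y1; have := iU y2; degree_lia.
      exact: cycle_degree.
    have := woodall2 W y12 n12 n21; rewrite /f /d.
    by rewrite !(outdegC a _ (covered C)) !(indegC a _ (covered C)); degree_lia.
  (* One path has at most [#|covered C|] closers, so neither vertex can hold most of the degree sum
     alone. *)
  have small y y' : y \in U -> 2 * #|V| <= j * 12 + (d y' + d y) -> 9 <= d y'.
    move=> yU ds; rewrite leqNgt; apply/negP=> lt9.
    have := alone y yU; move: ds lt9 w4 nV k2 jk; move: (d y) (d y') => dy dy'; card_lia.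
  have d1 : 9 <= d y1 by apply: (small y2).
  have d2 : 9 <= d y2 by apply: (small y1); rewrite // addnC [d y2 + _]addnC addnC.
  have [|x [s [us ps sz ys [sU cl]]]] := path0 y1 y1U; first exact: leq_trans d1.
  apply: (main x s y2 (d y1) us ps sz _ cl y2U _ d2).
  - by move=> z /sU[].
  - apply/negP=> /sU[_ [e|e|e]].
    + by rewrite e eqxx in y12.
    + by rewrite e in n12.
    + by rewrite e in n21.
  by move: dsum w4 nV k2 jk; move: (d y1) (d y2) => e1 e2; card_lia.
(* Any two vertices of [U] are now joined by an arc, so [y] has degree at least [#|U| - 1] in
   [U]. *)
move=> semi; have dall y : y \in U -> #|U| <= (d y).+1.
  move=> yU; have : #|U :\ y| <= d y.
    rewrite /d /outin /inin -cardsUI; apply: leq_trans (leq_addr _ _).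
    apply/subset_leq_card/subsetP=> z; rewrite in_setD1 in_setU !in_sep => /andP[zy zU].
    rewrite zU /=; apply: contraT; rewrite negb_or => /andP[nyz nzy]; case: semi.
    by exists y, z; rewrite eq_sym.
  by rewrite (cardsD1 y U) yU; move: (d y) => dy; card_lia.
have [y1 y1U] : exists y, y \in U by apply/card_gt0P; move: cU w4 nV jk; card_lia.
have [|x [s [us ps sz ys [sU cl]]]] := path0 y1 y1U.
  by have := dall _ y1U; move: cU w4 nV jk k2; move: (d y1) => e1; card_lia.
have cs : #|[set z in x :: s]| <= 3 by rewrite (card_set_seq us); case/andP: sz.
have [y2] : exists y, y \in U :\: [set z in x :: s].
  apply/card_gt0P; have := cardsID [set z in x :: s] U.
  have := subset_leq_card (subsetIr U [set z in x :: s]); move: cs cU w4 nV jk k2; card_lia.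
rewrite in_setD inE => /andP[y2n y2U].
have := dall _ y1U; have := dall _ y2U => D2 D1.
apply: (main x s y2 (d y1) us ps sz _ cl y2U y2n).
- by move=> z /sU[].
- by move: D2 cU w4 nV jk k2; move: (d y2) => e1; card_lia.
by move: D1 D2 cU w4 nV jk k2; move: (d y1) (d y2) => e1 e2; card_lia.
Qed.

End Step.

Lemma short_packing k j : 1 < k -> j <= k.+1 -> 12 * k + 3 <= #|V| ->
  exists C : 'I_j -> seq V, packing a C /\ forall i, size (C i) <= 4.
Proof.
move=> k2 jk nV; elim: j jk => [|j IH] jk.
  by exists (fun _ => [::]); split; [split=> [[]|[]] | case].
have [C [pC C4]] := IH (ltnW jk); apply: NNPP => no.
apply: (step_contra pC C4 _ k2 jk nV) => C' pC' C4'; apply: no; by exists C'.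
Qed.

End ShortPacking.

Theorem theorem1 (V : finType) (a : rel V) (k : nat) :
  irreflexive a ->
  0 < k ->
  12 * k + 3 <= #|V| ->
  (forall u v : V, u != v -> ~~ a u v -> #|V| <= outdeg a u + indeg a v) ->
  exists cs : seq (seq V),
    [/\ di2factor a cs, size cs = k & all (fun c => 3 <= size c) cs].
Proof.
move=> airr k0 nV W.
have [C [pC cC]] : has_factor a 'I_k.
  have [k1|k1] := eqVneq k 1.
    have [|c gc mc] := woodall_hamiltonian airr W; first by move: nV; rewrite k1; card_lia.
    exists (fun=> c); split; first split=> // i j x _ _.
      by apply: val_inj; rewrite /=; have := ltn_ord i; have := ltn_ord j; rewrite {2 4}k1; lia.
    by apply/setP=> x; rewrite in_setT; apply/coveredP; exists (Ordinal k0).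
  have k2 : 1 < k by rewrite ltn_neqAle eq_sym k1.
  have [C0 [pC0 _]] := short_packing airr W k2 (leqnn _) nV.
  have [C [pC mC]] := maximal_exists pC0.
  case: (classic (exists x, x \notin covered C)) => [|no].
    exact: (absorb_rest airr W pC mC).
  apply: (contract airr W k0 _ pC); first by move: nV k0; card_lia.
  by apply/setP=> x; rewrite in_setT; apply: contraT => nx; case: no; exists x.
exists [seq C i | i <- enum 'I_k]; split; last 2 first.
- by rewrite size_map size_enum_ord.
- by apply/allP=> _ /mapP[i _ ->]; exact: (packing_size i pC).
split.
- apply/allP=> _ /mapP[i _ ->]; rewrite /dicycle (packing_uniq i pC) (packing_cycle i pC).
  by rewrite (ltnW (packing_size i pC)).
- elim: (enum 'I_k) (enum_uniq 'I_k) => //= i l IH /andP[il ul].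
  rewrite cat_uniq (packing_uniq i pC) IH // andbT; apply/hasPn=> z.
  case/flatten_mapP=> i' i'l zi'; apply/negP=> zi; case: pC => _ dC.
  by rewrite (dC _ _ _ zi zi') i'l in il.
move=> v; have [i vi] : exists i, v \in C i by apply/coveredP; rewrite cC in_setT.
by apply/flatten_mapP; exists i; rewrite ?mem_enum.
Qed.
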